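(* Let $\Bbbk$ be a field, let $T$ be an unmixed balanced tree, and let $R=\Bbbk[V_{even}]$. Then $\mathrm{type}(R/\mathcal{N}_{odd}(T))$ equals the number of minimal $V_3$-TD-sets of $T$.
   Context: $N(v)=\{u:uv\in E\}$, $N(D)=\bigcup_{v\in D}N(v)$, $X_U=\prod_{v\in U}v$. A leaf is a vertex of degree 1; height of a vertex = minimum distance to a leaf (isolated vertex: 0); $V_k$ = vertices of height $k$; $V_{even}$, $V_{odd}$ = vertices of even/odd height; $T$ balanced means no two adjacent vertices have equal height. A TD-set is $D$ with $N(D)=V$, minimal if no proper subset is; $T$ unmixed if all minimal TD-sets have the same size. $\mathcal{N}_{odd}(T)$ is the ideal of $R$ generated by $X_{N(v)}$, $v\in V_{odd}$ (these lie in $R$ since $T$ is balanced). A $V_3$-TD-set is $D\subseteq V$ with $N(D)\supseteq V_3$, minimal if no proper subset is one (if $V_3=\emptyset$ the only minimal one is $\emptyset$). $\mathrm{type}$ denotes Cohen–Macaulay type (socle dimension over $\Bbbk$ after factoring out a maximal regular sequence in the homogeneous maximal ideal). *)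

(* Defs.v *)
From HB Require Import structures.
From mathcomp Require Import all_boot all_order all_algebra.
From mathcomp Require Import mpoly.

Set Implicit Arguments.
Unset Strict Implicit.
Unset Printing Implicit Defensive.

Import GRing.Theory.
Local Open Scope ring_scope.

Section Graph.
Variables (T : finType) (adj : rel T).

Definition nbhd (v : T) : {set T} := [set u | adj v u].
Definition nbhdS (D : {set T}) : {set T} := [set u | [exists v in D, adj v u]].

Definition is_tree : Prop :=
  [/\ ssrbool.symmetric adj, irreflexive adj, (0 < #|T|)%N,
      (forall x y, connect adj x y) &
      (forall s : seq T, uniq s -> (3 <= size s)%N -> ~~ cycle adj s)].

Definition leaf (v : T) : bool := #|nbhd v| == 1%N.

Fixpoint ball (k : nat) (v : T) : {set T} :=
  if k is k'.+1 then ball k' v :|: nbhdS (ball k' v) else [set v].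

Definition height (v : T) : nat :=
  if [exists u, leaf u] then
    find (fun k => [exists u in ball k v, leaf u]) (iota 0 #|T|)
  else 0%N.

Definition Vk (k : nat) : {set T} := [set v | height v == k].
Definition Veven : {set T} := [set v | ~~ odd (height v)].
Definition Vodd : {set T} := [set v | odd (height v)].

Definition balanced : Prop := forall u v, adj u v -> height u != height v.

Definition is_TD (D : {set T}) : bool := nbhdS D == setT.
Definition unmixed : Prop :=
  forall D1 D2, minset is_TD D1 -> minset is_TD D2 -> #|D1| = #|D2|.

Definition is_V3TD (D : {set T}) : bool := Vk 3 \subset nbhdS D.
Definition num_min_V3TD : nat := #|[set D : {set T} | minset is_V3TD D]|.
End Graph.

Section Algebra.
Variables (k : fieldType) (n : nat).
Local Notation R := {mpoly k[n]}.

Definition in_ideal (gs : seq R) (f : R) : Prop :=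
  exists cs : seq R, f = \sum_(i < size gs) cs`_i * gs`_i.

Definition homog_deg (d : nat) (p : R) : bool :=
  all (fun m => mdeg m == d) (msupp p).

Definition homog_in_max (p : R) : Prop :=
  exists d, (0 < d)%N /\ homog_deg d p.

Definition nzd_mod (gs : seq R) (g : R) : Prop :=
  forall f, in_ideal gs (g * f) -> in_ideal gs f.

Definition regular_seq (I th : seq R) : Prop :=
  (forall i, (i < size th)%N -> nzd_mod (I ++ take i th) th`_i) /\
  ~ in_ideal (I ++ th) 1.

Definition max_regular_seq (I th : seq R) : Prop :=
  [/\ (forall i, (i < size th)%N -> homog_in_max th`_i), regular_seq I th &
      forall g, homog_in_max g -> ~ nzd_mod (I ++ th) g].

Definition in_socle (J : seq R) (f : R) : Prop := forall i : 'I_n, in_ideal J ('X_i * f).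

Definition socle_dim (J : seq R) (N : nat) : Prop :=
  exists fs : seq R,
    [/\ size fs = N,
        (forall i, (i < N)%N -> in_socle J fs`_i),
        (forall cs : seq k, in_ideal J (\sum_(i < N) cs`_i *: fs`_i) ->
           forall i, (i < N)%N -> cs`_i = 0) &
        (forall f, in_socle J f ->
           exists cs : seq k, in_ideal J (f - \sum_(i < N) cs`_i *: fs`_i))].

Definition cm_type (I : seq R) (N : nat) : Prop :=
  forall th : seq R, max_regular_seq I th -> socle_dim (I ++ th) N.
End Algebra.

(* The ideal N_odd(T) in k[V_even], where the variables x_0..x_{n-1}
   are identified with the even-height vertices via e : 'I_n -> T *)
Definition Nodd_gens (k : fieldType) (T : finType) (adj : rel T) (n : nat)
  (e : 'I_n -> T) : seq {mpoly k[n]} :=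
  [seq \prod_(i : 'I_n | adj v (e i)) 'X_i | v <- enum (Vodd adj)].

(* Main.v *)
(* In an unmixed balanced tree with an edge all heights are at most 3, every even vertex has
   exactly one neighbour of height 1, and a vertex of height 1 has at most one
   neighbour that is not a leaf.  This follows from comparing, in the tree
   rooted at an even non-leaf, the sizes of irredundant covers of the odd
   vertices that are built greedily from the root.

   Hence the variables fall into disjoint blocks N(v), v of height 1, and the
   generators are the block products together with products, for v in V_3, of
   block representatives.  The differences x - r of a variable and the
   representative of its block form a regular sequence, modulo which the ideal
   becomes the Artinian ideal (r^|B_r|) + (X_N(v) : v in V_3); its socle has the
   basis of the monomials prod_(r not in D) r^(|B_r| - 1), where D runs through
   the minimal V_3-TD-sets.

   Any other maximal homogeneous regular sequence gives the same socle
   dimension: if a and b are regular modulo P, then b f = a g mod P matches the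
   socle modulo P + (a) with the one modulo P + (b), and homogeneous prime
   avoidance supplies common regular elements that turn one sequence into the
   other. *)
Require Import Defs.
From HB Require Import structures.
From mathcomp Require Import all_boot all_order all_algebra.
From mathcomp Require Import mpoly ring.
From Stdlib Require Import Classical ClassicalEpsilon.
From Stdlib Require List.
From Stdlib Require Import FunctionalExtensionality PropExtensionality.

Set Implicit Arguments.
Unset Strict Implicit.
Unset Printing Implicit Defensive.

Import GRing.Theory.
Local Open Scope ring_scope.

(** * Ideals as predicates *)

Section Ideals.
Variables (k : fieldType) (n : nat).
Local Notation R := {mpoly k[n]}.
Implicit Types (P Q : R -> Prop) (f g h a b : R) (gs : seq R).

(** Ideals are predicates rather than lists of generators, so that annihilators modulo an ideal can
    be formed without knowing generators. *)
Definition ideal P : Prop :=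
  [/\ P 0, forall f g, P f -> P g -> P (f + g) & forall h f, P f -> P (h * f)].

Lemma idealN P f : ideal P -> P f -> P (- f).
Proof. by case=> _ _ PM /(PM (-1)); rewrite mulN1r. Qed.

Lemma idealB P f g : ideal P -> P f -> P g -> P (f - g).
Proof. by move=> iP Pf Pg; case: (iP) => _ PD _; apply: PD => //; apply: idealN. Qed.

Lemma idealZ P (c : k) f : ideal P -> P f -> P (c *: f).
Proof. by case=> _ _ PM Pf; rewrite -mul_mpolyC; apply: PM. Qed.

Lemma ideal_sum P (I : Type) (r : seq I) (p : pred I) (F : I -> R) :
  ideal P -> (forall i, p i -> P (F i)) -> P (\sum_(i <- r | p i) F i).
Proof. by case=> P0 PD _ PF; apply: (big_ind P). Qed.

Lemma ideal_congr P f g : ideal P -> P (f - g) -> P f <-> P g.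
Proof.
move=> iP Pfg; split=> [Pf|Pg]; last by case: (iP) => _ PD _; rewrite -(subrK g f); apply: PD.
by rewrite -[g](subKr f); apply: idealB.
Qed.

Lemma in_ideal_ideal gs : ideal (in_ideal gs).
Proof.
split.
- by exists [::]; rewrite big1 // => i _; rewrite nth_nil mul0r.
- move=> f g [cs ->] [ds ->]; exists (mkseq (fun i => cs`_i + ds`_i) (size gs)).
  by rewrite -big_split; apply: eq_bigr => i _; rewrite nth_mkseq //= mulrDl.
- move=> h f [cs ->]; exists (mkseq (fun i => h * cs`_i) (size gs)).
  by rewrite mulr_sumr; apply: eq_bigr => i _; rewrite nth_mkseq // mulrA.
Qed.

Lemma mem_in_ideal gs g : g \in gs -> in_ideal gs g.
Proof.
move=> gs_g; exists (mkseq (fun i => (i == index g gs)%:R) (size gs)).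
have lti : (index g gs < size gs)%N by rewrite index_mem.
rewrite (bigD1 (Ordinal lti)) //= nth_mkseq // eqxx mul1r nth_index //.
rewrite big1 ?addr0 // => i nei; rewrite nth_mkseq //.
by rewrite (_ : _ == _ = false) ?mul0r //; apply: contraNF nei.
Qed.

Lemma in_ideal_min P gs f :
  ideal P -> (forall g, g \in gs -> P g) -> in_ideal gs f -> P f.
Proof.
move=> iP Pgs [cs ->]; apply: ideal_sum => // i _.
by case: (iP) => _ _ PM; apply: PM; apply/Pgs/mem_nth.
Qed.

Lemma in_ideal_sub gs hs f :
  (forall g, g \in gs -> in_ideal hs g) -> in_ideal gs f -> in_ideal hs f.
Proof. exact: in_ideal_min (in_ideal_ideal hs). Qed.

Definition addI P a : R -> Prop := fun f => exists c, P (f - c * a).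

Lemma addI_ideal P a : ideal P -> ideal (addI P a).
Proof.
move=> iP; case: (iP) => P0 PD PM; split; first by exists 0; rewrite mul0r subr0.
- move=> f g [c Pc] [d Pd]; exists (c + d).
  by rewrite mulrDl opprD addrACA; apply: PD.
- by move=> h f [c /(PM h)]; rewrite mulrBr mulrA; exists (h * c).
Qed.

Lemma addI_sub P a f : P f -> addI P a f.
Proof. by exists 0; rewrite mul0r subr0. Qed.

Lemma addI_mem P a : ideal P -> addI P a a.
Proof. by case=> P0 _ _; exists 1; rewrite mul1r subrr. Qed.

(** Ideals with the same elements become equal, so they can be rewritten inside [foldl], [reg] and
    [socdim]. *)
Lemma pred_ext P Q : (forall f, P f <-> Q f) -> P = Q.
Proof.
by move=> PQ; apply: functional_extensionality => f; apply: propositional_extensionality.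
Qed.

Lemma addIC P a b : addI (addI P a) b = addI (addI P b) a.
Proof. by apply: pred_ext => f; split=> -[c [d Pf]]; exists d, c; rewrite addrAC. Qed.

Lemma in_ideal_rcons gs a : in_ideal (rcons gs a) = addI (in_ideal gs) a.
Proof.
have iI := in_ideal_ideal.
apply: pred_ext => f; split.
  apply: in_ideal_min; first exact/addI_ideal/iI.
  move=> g; rewrite mem_rcons inE => /predU1P[->|gs_g]; first exact/addI_mem/iI.
  exact/addI_sub/mem_in_ideal.
case=> c Pf; rewrite -(subrK (c * a) f); case: (iI (rcons gs a)) => _ PD PM.
apply: PD; last by apply/PM/mem_in_ideal; rewrite mem_rcons mem_head.
by apply: in_ideal_sub Pf => g gs_g; apply: mem_in_ideal; rewrite mem_rcons inE gs_g orbT.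
Qed.

Lemma in_ideal_foldl gs th : in_ideal (gs ++ th) = foldl addI (in_ideal gs) th.
Proof.
elim: th gs => [|a th IH] gs; first by rewrite cats0.
by rewrite -cat_rcons IH in_ideal_rcons.
Qed.

(** * Homogeneous components and homogeneous ideals *)

Definition homI P : Prop := forall f d, P f -> P (pihomog mdeg d f).

Lemma homog_degE d f : homog_deg d f = (f \is d.-homog).
Proof. by rewrite dhomogE. Qed.

Lemma pihomog_sum_msize f : f = \sum_(d < msize f) pihomog mdeg d f.
Proof. exact: (@pihomog_partitionE n k mdeg _ f). Qed.

Lemma homIP P f : ideal P -> (forall d, P (pihomog mdeg d f)) -> P f.
Proof. by move=> iP Pf; rewrite [f]pihomog_sum_msize; apply: ideal_sum. Qed.

Lemma pihomogM_homog d e f g : g \is e.-homog ->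
  pihomog mdeg (d + e) (f * g) = pihomog mdeg d f * g.
Proof.
move=> hg; have [le_df | lt_fd] := ltnP d (msize f); last first.
  rewrite {1}[f]pihomog_sum_msize mulr_suml raddf_sum big1 /=.
    have -> : pihomog mdeg d f = 0; last by rewrite mul0r.
    rewrite pihomogE big_seq_cond big1 // => m /andP[/msize_mdeg_lt lt_m /eqP Em].
    by rewrite Em ltnNge lt_fd in lt_m.
  move=> i _; apply: (@pihomog_ne0 n k mdeg (i + e)%N).
    by rewrite eqn_add2r neq_ltn (leq_trans (ltn_ord i)).
  exact/dhomogM/hg/pihomogP.
rewrite {1}[f]pihomog_sum_msize mulr_suml raddf_sum (bigD1 (Ordinal le_df)) //= big1 ?addr0.
  by rewrite pihomog_dE //; apply/dhomogM/hg/pihomogP.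
move=> i nei; apply: (@pihomog_ne0 n k mdeg (i + e)%N).
  by rewrite eqn_add2r; apply: contraNneq nei => eid; apply/eqP/val_inj.
exact/dhomogM/hg/pihomogP.
Qed.

Lemma pihomogM_small d e f g : g \is e.-homog -> (d < e)%N ->
  pihomog mdeg d (f * g) = 0.
Proof.
move=> hg lt_de; rewrite {1}[f]pihomog_sum_msize mulr_suml raddf_sum big1 //= => i _.
apply: (@pihomog_ne0 n k mdeg (i + e)%N); last exact/dhomogM/hg/pihomogP.
by rewrite neq_ltn ltn_addl ?orbT.
Qed.

Lemma pihomogM_multiple d e f g : g \is e.-homog ->
  exists c, pihomog mdeg d (f * g) = c * g.
Proof.
move=> hg; have [le_ed | lt_de] := leqP e d; last
  by exists 0; rewrite mul0r (pihomogM_small f hg).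
by exists (pihomog mdeg (d - e) f); rewrite -(subnK le_ed) (pihomogM_homog _ _ hg) addnK.
Qed.

Lemma addI_hom P a d : homI P -> a \is d.-homog -> homI (addI P a).
Proof.
move=> hP ha f e [c /(hP _ e)]; rewrite raddfB /=.
by have [c' ->] := pihomogM_multiple e c ha; exists c'.
Qed.

Lemma in_ideal_nil f : in_ideal [::] f <-> f = 0.
Proof. by split=> [[cs ->]|->]; [rewrite big_ord0 | case: (in_ideal_ideal [::])]. Qed.

Lemma in_ideal_hom gs : (forall g, g \in gs -> exists d, g \is d.-homog) ->
  homI (in_ideal gs).
Proof.
elim/last_ind: gs => [|gs a IH] hgs.
  by move=> f d /in_ideal_nil ->; rewrite raddf0; apply/in_ideal_nil.
rewrite in_ideal_rcons; case: (hgs a) => [|d ha]; first by rewrite mem_rcons mem_head.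
by apply: addI_hom ha; apply: IH => g gs_g; apply: hgs; rewrite mem_rcons inE gs_g orbT.
Qed.

End Ideals.
(** * Noetherianity and homogeneous prime avoidance *)

(** Induction on the number [j] of compared coordinates. If [s0] works for the first [j] of them and
    [N] bounds the next coordinate on [s0], then [s0] handles every [m] whose next coordinate is at
    least [N]; each of the finitely many slices below [N] is handled by induction. *)
Lemma dickson (n : nat) (L : 'X_{1..n} -> Prop) :
  exists s : seq 'X_{1..n}, (forall m, m \in s -> L m) /\
    (forall m, L m -> exists2 m', m' \in s & (m' <= m)%MM).
Proof.
suff D (j : nat) (K : 'X_{1..n} -> Prop) : exists s : seq 'X_{1..n},
    (forall m, m \in s -> K m) /\
    (forall m, K m -> exists2 m', m' \in s & forall i : 'I_n, (i < j)%N -> (m' i <= m i)%N).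
  case: (D n L) => s [sL Ls]; exists s; split=> // m /Ls[m' s_m' le_m].
  by exists m' => //; apply/mnm_lepP => i; apply/le_m/ltn_ord.
elim: j K => [|j IH] K.
  have [[m Km]|nK] := classic (exists m, K m).
    exists [:: m]; split=> [_ /[!inE]/eqP->//|m' _]; exists m; rewrite ?mem_head //.
  by exists [::]; split=> // m Km; case: nK; exists m.
case: (IH K) => s0 [s0K Ks0].
have [lt_jn | le_nj] := ltnP j n; last first.
  exists s0; split=> // m /Ks0[m' s0_m' le_m]; exists m' => // i _.
  exact/le_m/(leq_trans (ltn_ord i)).
pose j0 := Ordinal lt_jn; pose N := \max_(m <- s0) m j0.
have [F FP] : exists F : nat -> seq 'X_{1..n}, forall v,
    (forall m, m \in F v -> K m /\ m j0 = v) /\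
    (forall m, K m -> m j0 = v -> exists2 m', m' \in F v &
      forall i : 'I_n, (i < j)%N -> (m' i <= m i)%N).
  apply: (choice (fun v s => (forall m, m \in s -> K m /\ m j0 = v) /\
    (forall m, K m -> m j0 = v -> exists2 m', m' \in s &
      forall i : 'I_n, (i < j)%N -> (m' i <= m i)%N))) => v.
  case: (IH (fun m => K m /\ m j0 = v)) => s [sK Ks]; exists s; split=> // m Km Em.
  exact: Ks.
exists (s0 ++ flatten (map F (iota 0 N))); split=> [m|m Km].
  by rewrite mem_cat => /orP[/s0K//|/flatten_mapP[v _ /(FP v).1[]]].
have [le_Nm | lt_mN] := leqP N (m j0).
  case: (Ks0 m Km) => m' s0_m' le_m; exists m'; first by rewrite mem_cat s0_m'.
  move=> i; rewrite ltnS leq_eqVlt => /predU1P[Ei|/le_m//].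
  have -> : i = j0 by apply: val_inj.
  exact: leq_trans (leq_bigmax_seq _ s0_m' _) le_Nm.
case: ((FP (m j0)).2 m Km erefl) => m' Fm' le_m; exists m'.
  by rewrite mem_cat; apply/orP; right; apply/flatten_mapP; exists (m j0); rewrite ?mem_iota.
move=> i; rewrite ltnS leq_eqVlt => /predU1P[Ei|/le_m//].
have -> : i = j0 by apply: val_inj.
by rewrite ((FP (m j0)).1 _ Fm').2.
Qed.

Section Noetherian.
Variables (k : fieldType) (n : nat).
Local Notation R := {mpoly k[n]}.
Implicit Types (P Q F : R -> Prop) (f g h a b : R) (gs : seq R).

(** Dickson's lemma selects finitely many leading monomials of the ideal [I] spanned by [F];
    finitely many elements of [F] realise them, and division by leading terms reduces all of [I] to
    these. *)
Lemma hilbert_basis F : exists s : seq R,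
  (forall f, f \in s -> F f) /\ (forall f, F f -> in_ideal s f).
Proof.
pose fin (s : seq R) := forall f, f \in s -> F f.
pose I f := exists2 s, fin s & in_ideal s f.
have I_comb (r : seq 'X_{1..n}) :
    (forall m, m \in r -> exists f, [/\ I f, f != 0 & mlead f = m]) ->
    exists2 s, fin s & forall m, m \in r -> exists f, [/\ in_ideal s f, f != 0 & mlead f = m].
  elim: r => [|m r IH] Hr; first by exists [::].
  case: IH => [x rx|s fs sP]; first by apply: Hr; rewrite inE rx orbT.
  case: (Hr m (mem_head _ _)) => f [[s' fs' s'f] nz_f lf].
  exists (s' ++ s) => [g|x]; first by rewrite mem_cat => /orP[/fs'|/fs].
  rewrite inE => /predU1P[->|/sP[g [sg nz_g lg]]].
    exists f; split=> //; apply: in_ideal_sub s'f => g gs.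
    by apply: mem_in_ideal; rewrite mem_cat gs.
  exists g; split=> //; apply: in_ideal_sub sg => h hs.
  by apply: mem_in_ideal; rewrite mem_cat hs orbT.
case: (dickson (fun m => exists f, [/\ I f, f != 0 & mlead f = m])) => r [rL Lr].
case: (I_comb r rL) => s fs sP; exists s; split=> // f Ff.
have : I f by exists [:: f]; [move=> g; rewrite inE => /eqP-> | apply/mem_in_ideal/mem_head].
move: {2}(mlead f) (erefl (mlead f)) => m.
elim/(well_founded_ind (@ltom_wf n)): m f {Ff} => m IH f lf If.
have [-> | nz_f] := eqVneq f 0; first by case: (in_ideal_ideal s).
have [|m' r_m' le_m] := Lr m; first by exists f.
have [g [sg nz_g lg]] := sP m' r_m'.
(* [h] has the leading term of [f], so [f - h] vanishes or has a smaller leading monomial. *)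
pose c := mleadc f / mleadc g; pose h := (c *: 'X_[m - m']) * g.
have lc_g : mleadc g != 0 by rewrite mleadc_eq0.
have lc_f : mleadc f != 0 by rewrite mleadc_eq0.
have nz_c : c != 0 by rewrite mulf_neq0 ?invr_eq0.
have nz_X : c *: 'X_[m - m'] != 0 :> R by rewrite scaler_eq0 negb_or nz_c -msupp_eq0 msuppX.
have lh : mlead h = m by rewrite mleadM // mleadZ // mleadXm lg submK.
have sh : in_ideal s h by case: (in_ideal_ideal s) => _ _; apply.
apply/(ideal_congr (in_ideal_ideal s) (f := f) (g := f - h)); first by rewrite subKr.
have [->|nz_fh] := eqVneq (f - h) 0; first by case: (in_ideal_ideal s).
have Ifh : I (f - h).
  case: If => s' fs' s'f; exists (s' ++ s) => [x|]; first by rewrite mem_cat => /orP[/fs'|/fs].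
  apply: (idealB (in_ideal_ideal _)).
    by apply: in_ideal_sub s'f => x xs; apply: mem_in_ideal; rewrite mem_cat xs.
  by apply: in_ideal_sub sh => x xs; apply: mem_in_ideal; rewrite mem_cat xs orbT.
apply: (IH (mlead (f - h))) => //.
have le_fh : (mlead (f - h) <= m)%O.
  by apply: Order.POrderTheory.le_trans (mleadB_le _ _) _; rewrite lh lf Order.JoinTheory.joinxx.
rewrite Order.POrderTheory.lt_neqAle le_fh andbT; apply/eqP => E.
have : (f - h)@_m != 0 by rewrite -E mleadc_eq0.
rewrite mcoeffB -{1}lf -lh mleadcM_proper; last first.
  by rewrite mulf_neq0 // mleadc_eq0.
by rewrite mleadZ // mcoeffZ mleadXm mcoeffX eqxx mulr1 divfK ?subrr ?eqxx.
Qed.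

(** A strictly increasing chain, built by choice, would have a finitely generated union, and the
    generators already lie in one member. *)
Lemma ideal_acc (I : Type) (A : I -> R -> Prop) (i0 : I) : (forall i, ideal (A i)) ->
  exists i, (forall f, A i0 f -> A i f) /\
    forall j, (forall f, A i f -> A j f) -> forall f, A j f -> A i f.
Proof.
move=> iA; apply: NNPP => noMax.
pose S := {i : I | forall f, A i0 f -> A i f}.
have next (x : S) : exists y : S, (forall f, A (sval x) f -> A (sval y) f) /\
    exists f, A (sval y) f /\ ~ A (sval x) f.
  apply: NNPP => noY; apply: noMax; exists (sval x); split; first exact: (svalP x).
  move=> j sxj f jf; apply: NNPP => nxf; apply: noY.
  by exists (exist _ j (fun f A0f => sxj f (svalP x f A0f))); split=> //; exists f.
case: (choice _ next) => nx nxP.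
pose x0 : S := exist _ i0 (fun f A0f => A0f); pose sq t := sval (iter t nx x0).
have mono s t : (s <= t)%N -> forall f, A (sq s) f -> A (sq t) f.
  elim: t => [|t IH]; first by rewrite leqn0 => /eqP->.
  rewrite leq_eqVlt => /predU1P[->//|/IH st] f /st; exact: (nxP _).1.
case: (hilbert_basis (fun f => exists t, A (sq t) f)) => s [sU Us].
have [N AN] : exists N, forall f, f \in s -> A (sq N) f.
  elim: s {Us} sU => [|f s IH] sU; first by exists 0%N.
  case: IH => [g sg|N AN]; first by apply: sU; rewrite inE sg orbT.
  case: (sU f (mem_head _ _)) => M AM; exists (maxn N M) => g.
  rewrite inE => /predU1P[->|/AN]; last by apply: mono; apply: leq_maxl.
  by apply: mono AM; apply: leq_maxr.
case: (nxP (iter N nx x0)) => _ [f [Af nAf]]; apply: nAf.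
by apply: in_ideal_min (iA _) AN _; apply: Us; exists N.+1.
Qed.

End Noetherian.
Lemma In_mem (T : eqType) (x : T) (s : seq T) : List.In x s <-> x \in s.
Proof.
elim: s => [|y s IH] //=; rewrite inE IH.
split=> [[->|->]|/predU1P[->|]]; rewrite ?eqxx ?orbT //.
  by left.
by right.
Qed.

Section PrimeAvoidance.
Variables (k : fieldType) (n : nat).
Local Notation R := {mpoly k[n]}.
Implicit Types (P Q : R -> Prop) (f g h a b : R) (Qs : list (R -> Prop)).

Definition soc P : R -> Prop := fun f => forall i : 'I_n, P ('X_i * f).
(** For a homogeneous ideal this amounts to a homogeneous regular element of positive degree, by
    [common_nzd] and [nzd_zero_soc]. *)
Definition zero_soc P : Prop := forall f, soc P f -> P f.
Definition nzd P g : Prop := forall f, P (g * f) -> P f.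

(** The missing variable excludes the irrelevant ideal, which no element of positive degree
    avoids. *)
Definition hprime Q : Prop := [/\ ideal Q, exists i : 'I_n, ~ Q 'X_i &
  forall d e g h, g \is d.-homog -> h \is e.-homog -> Q (g * h) -> Q g \/ Q h].

Lemma hprime_exp Q d g m : hprime Q -> g \is d.-homog -> Q (g ^+ m) -> Q g.
Proof.
case=> [[Q0 QD QM] [i ni] Qp] hg; elim: m => [Q1|m IH].
  by case: ni; rewrite -(mulr1 'X_i); apply: QM.
by rewrite exprS => /(Qp _ _ _ _ hg (dhomogMn m hg))[].
Qed.

(* The primes are the maximal annihilators modulo [P] of homogeneous elements;
   finitely many such elements generate the ideal spanned by all of them, so
   that finitely many primes suffice. *)
Lemma hprimes_cover P : ideal P -> homI P -> zero_soc P ->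
  exists Qs, (forall Q, List.In Q Qs -> hprime Q) /\
    forall d g, g \is d.-homog -> (forall Q, List.In Q Qs -> ~ Q g) -> nzd P g.
Proof.
move=> iP hP zP; pose A f : R -> Prop := fun g => P (g * f).
case: (iP) => P0 PD PM.
have iA f : ideal (A f).
  by split=> [|g h|g h]; rewrite /A ?mul0r ?mulrDl -?mulrA //; [apply: PD|apply: PM].
have hA d f : f \is d.-homog -> homI (A f).
  by move=> hf g e /(hP _ (e + d)%N); rewrite (pihomogM_homog _ _ hf).
pose I := {f : R | exists2 d, f \is d.-homog & ~ P f}.
pose maxA f := (exists2 d, f \is d.-homog & ~ P f) /\
  forall f' : I, (forall g, A f g -> A (sval f') g) -> forall g, A (sval f') g -> A f g.
have [s [sM Ms]] := hilbert_basis maxA.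
have primeA f : maxA f -> hprime (A f).
  case=> -[d hf nPf] mf; split=> //.
    apply: NNPP => nX; apply/nPf/zP => i; apply: NNPP => nXi; apply: nX.
    by exists i.
  move=> e e' g h hg hh; rewrite /A -mulrA => Pghf; apply: NNPP => /not_or_and[nPg nPh].
  have Ihf : exists2 d, h * f \is d.-homog & ~ P (h * f).
    by exists (e' + d)%N => //; apply: dhomogM.
  (* The annihilator of [h * f] contains that of [f], so by maximality they coincide. *)
  apply: nPg; apply: (mf (exist _ _ Ihf)) => //= q; rewrite /A mulrCA; exact: PM.
exists (List.map A s); split=> [Q /List.in_map_iff[f [<- /In_mem fs]]|].
  exact/primeA/sM.
move=> d g hg ng f Pgf; apply: homIP => // e; apply: NNPP => nPf.
have If : exists2 d, pihomog mdeg e f \is d.-homog & ~ P (pihomog mdeg e f).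
  by exists e => //; apply: pihomogP.
have [[f' If'] [/= sub_ff' mf']] := ideal_acc (exist _ _ If : I) (fun i => iA (sval i)).
have Mf' : maxA f' by split.
have Agf' : A f' g.
  apply: sub_ff'; rewrite /A mulrC -(pihomogM_homog _ _ hg) mulrC; exact: hP.
(* Otherwise every element of [s] has a homogeneous annihilator outside the prime [A f']; the
   product of these stays outside, yet kills [f'], which is a combination of [s]. *)
have [f1 s_f1 f1P] : exists2 f1, f1 \in s &
    forall c q, q \is c.-homog -> A f1 q -> A f' q.
  apply: NNPP => nof1.
  have [q [c hq [qs nq]]] : exists q, exists2 c, q \is c.-homog &
      (forall f1, f1 \in s -> A f1 q) /\ ~ A f' q.
    have: forall f1, f1 \in s -> exists q c, [/\ q \is c.-homog, A f1 q & ~ A f' q].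
      move=> f1 sf1; apply: NNPP => noq; apply: nof1; exists f1 => // c q hq Aq.
      by apply: NNPP => nq; apply: noq; exists q, c.
    elim: s {sM Ms ng nof1} => [_|f1 s IH sP].
      exists 1, 0%N; first exact: dhomog1.
      by split=> //; rewrite /A mul1r; case: If'.
    case: IH => [x sx|q [c hq [qs nq]]]; first by apply: sP; rewrite inE sx orbT.
    case: (sP f1 (mem_head _ _)) => q1 [c1 [hq1 q1f1 nq1]].
    exists (q1 * q), (c1 + c)%N; first exact: dhomogM.
    split=> [x|]; last first.
      by case: (primeA _ Mf') => _ _ pr /(pr _ _ _ _ hq1 hq)[].
    rewrite inE => /predU1P[->|/qs]; last by case: (iA x) => _ _; apply.
    by rewrite mulrC; case: (iA f1) => _ _; apply.
  apply: nq; rewrite /A.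
  have : in_ideal s f' by apply: Ms.
  apply: (@in_ideal_min k n (fun x => P (q * x))) => //.
  by split=> [|x y|x y]; rewrite ?mulr0 // ?mulrDr 1?mulrCA; [apply: PD|apply: PM].
apply: (ng (A f1)); first by apply: List.in_map; apply/In_mem.
case: (sM f1 s_f1) => -[c hf1 _] mf1; apply: (mf1 (exist _ f' If')) => //= q Aq.
apply: homIP => // e'; apply: (f1P e'); first exact: pihomogP.
by apply: (hA c).
Qed.

(* If [g] lies in the new prime [P] and avoids the others, take [h] outside [P]
   and inside every other prime that is not contained in [P]: then
   [g ^+ deg h + h ^+ deg g] avoids them all. *)
Lemma prime_avoidance Qs : (forall Q, List.In Q Qs -> hprime Q) ->
  exists d g, [/\ (0 < d)%N, g \is d.-homog & forall Q, List.In Q Qs -> ~ Q g].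
Proof.
elim: Qs => [_|P Qs IH pQs]; first by exists 1%N, 0; split=> //; apply: dhomog0.
case: IH => [Q QQs|d [g [d_gt0 hg gP]]]; first by apply: pQs; right.
have pP : hprime P by apply: pQs; left.
have [Pg | nPg] := classic (P g); last first.
  by exists d, g; split=> // Q [<-//|]; apply: gP.
(* [h] is a product of a variable outside [P] with one homogeneous factor from each prime not
   contained in [P]. *)
have [e [h [e_gt0 hh nPh hQs]]] : exists e h, [/\ (0 < e)%N, h \is e.-homog, ~ P h &
    forall Q, List.In Q Qs -> Q h \/ (forall c q, q \is c.-homog -> Q q -> P q)].
  have {gP} : forall Q, List.In Q Qs -> ideal Q by move=> Q QQs; case: (pQs Q) => //; right.
  elim: Qs {pQs} => [_|Q Qs IH iQs].
    by case: pP => _ [i nPi] _; exists 1%N, 'X_i; split=> //; rewrite dhomogX /= mdeg1.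
  case: IH => [Q' Q'Qs|e [h [e_gt0 hh nPh hQs]]]; first by apply: iQs; right.
  have [[c [q [hq Qq nPq]]] | noq] := classic (exists c q, [/\ q \is c.-homog, Q q & ~ P q]).
    exists (c + e)%N, (q * h); split; rewrite ?addn_gt0 ?e_gt0 ?orbT //; first exact: dhomogM.
      by case: pP => _ _ pr /(pr _ _ _ _ hq hh)[].
    move=> Q' [<-|QQ'].
      by left; rewrite mulrC; case: (iQs Q) => [|_ _]; [left|apply].
    have iQ' : ideal Q' by apply: iQs; right.
    by case: (hQs _ QQ') => [Qh|?]; [left; case: iQ' => _ _; apply | right].
  exists e, h; split=> // Q' [<-|/hQs//]; right=> c q hq Qq.
  by apply: NNPP => nPq; apply: noq; exists c, q.
have hG : g ^+ e + h ^+ d \is (d * e).-homog.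
  by apply: dhomogD; [apply: dhomogMn | rewrite mulnC; apply: dhomogMn].
have nPG : ~ P (g ^+ e + h ^+ d).
  case: (pP) => -[P0 PD PM] _ _ PG; apply/nPh/(hprime_exp pP hh (m := d)).
  apply/(ideal_congr (f := h ^+ d) (g := g ^+ e + h ^+ d)) => //.
  rewrite opprD addrCA subrr addr0; apply: idealN => //.
  by rewrite -(prednK e_gt0) exprSr; apply: PM.
exists (d * e)%N, (g ^+ e + h ^+ d); split; rewrite ?muln_gt0 ?d_gt0 // => Q [<-//|QQs] QG.
have pQ : hprime Q by apply: pQs; right.
case: (hQs _ QQs) => [Qh|/(_ _ _ hG QG)//].
apply: (gP _ QQs); apply/(hprime_exp pQ hg (m := e)).
case: pQ => iQ _ _; apply/(ideal_congr (f := g ^+ e) (g := g ^+ e + h ^+ d)) => //.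
rewrite opprD addrA subrr sub0r; apply: idealN => //.
by case: iQ => _ _ QM; rewrite -(prednK d_gt0) exprSr; apply: QM.
Qed.

(** Each ideal contributes the finitely many primes of [hprimes_cover]; an element avoiding them all
    is regular modulo every ideal of the list. *)
Lemma common_nzd (Ps : list (R -> Prop)) :
  (forall P, List.In P Ps -> [/\ ideal P, homI P & zero_soc P]) ->
  exists d g, [/\ (0 < d)%N, g \is d.-homog & forall P, List.In P Ps -> nzd P g].
Proof.
move=> PsP.
suff [Qs [pQs Qsg]] : exists Qs, (forall Q, List.In Q Qs -> hprime Q) /\
    forall d g, g \is d.-homog -> (forall Q, List.In Q Qs -> ~ Q g) ->
      forall P, List.In P Ps -> nzd P g.
  have [d [g [d_gt0 hg gQs]]] := prime_avoidance pQs.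
  by exists d, g; split=> //; apply: Qsg hg gQs.
elim: Ps PsP => [_|P Ps IH PsP]; first by exists nil; split.
case: IH => [P' PP'|Qs [pQs Qsg]]; first by apply: PsP; right.
case: (PsP P) => [|iP hP zP]; first by left.
have [Qs' [pQs' Qsg']] := hprimes_cover iP hP zP.
exists (app Qs' Qs); split=> [Q /List.in_app_iff[]|d g hg ng Q]; [exact: pQs'|exact: pQs|].
case=> [<-|]; first by apply: (Qsg' d) => // Q' QQ'; apply: ng; apply/List.in_app_iff; left.
by apply: (Qsg d) => // Q' QQ'; apply: ng; apply/List.in_app_iff; right.
Qed.

End PrimeAvoidance.
(** * Independence of the maximal regular sequence *)

Section CMType.
Variables (k : fieldType) (n : nat).
Local Notation R := {mpoly k[n]}.
Implicit Types (P Q : R -> Prop) (f g h a b c : R) (gs th : seq R).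

(** The form of [socle_dim] for predicates; on [in_ideal J] the two are convertible. *)
Definition socdim P (N : nat) : Prop :=
  exists fs : seq R,
    [/\ size fs = N,
        (forall i, (i < N)%N -> soc P fs`_i),
        (forall cs : seq k, P (\sum_(i < N) cs`_i *: fs`_i) ->
           forall i, (i < N)%N -> cs`_i = 0) &
        (forall f, soc P f ->
           exists cs : seq k, P (f - \sum_(i < N) cs`_i *: fs`_i))].

Lemma zero_socP P : zero_soc P <-> socdim P 0.
Proof.
split=> [zP|[fs [_ _ _ fsP]] f /fsP[cs]]; last by rewrite big_ord0 subr0.
by exists [::]; split=> // f /zP; exists [::]; rewrite big_ord0 subr0.
Qed.

(** Every monomial of [b] has positive degree and so contains a variable, which already sends [f]
    into [P]. *)
Lemma homog_in_max_mul P f b : ideal P -> homog_in_max b -> soc P f -> P (b * f).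
Proof.
move=> iP [d [d_gt0 /allP hb]] sf; rewrite [b]mpolyE mulr_suml big_seq.
apply: ideal_sum => // m /hb /eqP Em; rewrite -scalerAl; apply: idealZ => //.
have [i mi] : exists i : 'I_n, m i != 0%N.
  apply/existsP; apply: contraLR d_gt0 => /existsPn m0.
  by rewrite -Em mdegE big1 // => i _; apply/eqP; move: (m0 i); rewrite negbK.
rewrite -(submK (m := U_(i)) (m' := m)) ?lep1mP // mpolyXD -mulrA.
by case: (iP) => _ _; apply; apply: sf.
Qed.

Lemma nzd_zero_soc P b : ideal P -> homog_in_max b -> nzd P b -> zero_soc P.
Proof. by move=> iP hb nb f /(homog_in_max_mul iP hb)/nb. Qed.

(* The correspondence [b f = a g] modulo [P] matches the socle modulo [P + (a)]
   with the socle modulo [P + (b)]. *)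
Lemma soc_exchange P a b f g : ideal P -> nzd P a ->
  soc (addI P a) f -> P (b * f - a * g) -> soc (addI P b) g.
Proof.
move=> iP na sf Pfg i; case: (sf i) => h Ph; exists h; apply: na.
case: (iP) => _ PD PM.
have -> : a * ('X_i * g - h * b) = b * ('X_i * f - h * a) - 'X_i * (b * f - a * g).
  by ring.
by apply: idealB; [|apply: PM|apply: PM].
Qed.

Lemma addI_socE P a b f : ideal P -> homog_in_max b -> soc (addI P a) f ->
  exists g, P (b * f - a * g).
Proof.
move=> iP hb /(homog_in_max_mul (addI_ideal a iP) hb)[g Pg].
by exists g; rewrite (mulrC a).
Qed.

(** A socle basis is carried over to the elements [G i]. Independence cancels [b]; spanning goes
    back from [g] to some [f] and cancels [a]. *)
Lemma socdim_exchange P a b N : ideal P -> homog_in_max a -> homog_in_max b ->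
  nzd P a -> nzd P b -> socdim (addI P a) N -> socdim (addI P b) N.
Proof.
move=> iP ha hb na nb [fs [sfs fs_soc fs_free fs_span]].
case: (iP) => P0 PD PM.
have [G GP] : exists G : nat -> R, forall i, (i < N)%N -> P (b * fs`_i - a * G i).
  apply: (choice (fun i g => (i < N)%N -> P (b * fs`_i - a * g))) => i.
  have [lt_iN|] := boolP (i < N)%N; last by exists 0.
  by have [g Pg] := addI_socE iP hb (fs_soc i lt_iN); exists g.
have sumG (cs : seq k) : P (b * (\sum_(i < N) cs`_i *: fs`_i)
    - a * (\sum_(i < N) cs`_i *: (mkseq G N)`_i)).
  rewrite !mulr_sumr -sumrB; apply: ideal_sum => // i _.
  by rewrite nth_mkseq // -!scalerAr -scalerBr; apply: idealZ => //; apply: GP.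
exists (mkseq G N); split; first by rewrite size_mkseq.
- move=> i lt_iN; rewrite nth_mkseq //.
  by apply: (soc_exchange iP na (fs_soc i lt_iN)); apply: GP.
- move=> cs [h Ph]; apply: (fs_free cs).
  exists h; apply: nb; rewrite mulrBr.
  set S := \sum_(i < N) _; set S' := \sum_(i < N) _ in Ph.
  have -> : b * S - b * (h * a) = (b * S - a * S') + a * (S' - h * b) by ring.
  by apply: PD; [apply: sumG | apply: PM].
- move=> g sg; have [f Pf] := addI_socE iP ha sg.
  have sf : soc (addI P a) f by apply: (soc_exchange iP nb sg Pf).
  have [cs [h Ph]] := fs_span f sf; exists cs, h; apply: na.
  set S := \sum_(i < N) _; set S' := \sum_(i < N) cs`_i *: fs`_i in Ph.
  have -> : a * (g - S - h * b) = (a * g - b * f) + b * (f - S' - h * a) + (b * S' - a * S).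
    by ring.
  apply: (PD _ _ _ (sumG cs)); apply: (PD _ _ Pf); exact: PM.
Qed.

(** Here the ideal grows along the list; properness of the last quotient enters below through its
    nonzero socle. *)
Fixpoint reg P th : Prop :=
  if th is a :: th' then [/\ homog_in_max a, nzd P a & reg (addI P a) th'] else True.

(** From [a f = h b] modulo [P], regularity of [b] modulo [P + (a)] gives [h = h' a], and cancelling
    [a] puts [f] into [P + (b)]. *)
Lemma nzd_swap P a b : ideal P -> nzd P a -> nzd (addI P a) b -> nzd (addI P b) a.
Proof.
move=> iP na nb f [h Ph].
have /nb[h' Ph'] : addI P a (b * h).
  exists f; rewrite -opprB; apply: idealN => //.
  by rewrite mulrC (mulrC b).
exists h'; apply: na.
have -> : a * (f - h' * b) = (a * f - h * b) + b * (h - h' * a) by ring.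
by case: (iP) => _ PD PM; apply: PD Ph _; apply: PM.
Qed.

Lemma addI_homog_in_max P a : homI P -> homog_in_max a -> homI (addI P a).
Proof. by move=> hP [d [_ ha]]; rewrite homog_degE in ha; apply: addI_hom ha. Qed.

(* With [d] regular modulo [P], [P + (a)] and [P + (c)], the sequence [a, th] is
   replaced by [a, d, g], then by [d, c, g'], and two consecutive elements are
   swapped each time; choosing [d] regular modulo [P] avoids Nakayama. *)
Lemma reg_exchange P th c : ideal P -> homI P -> reg P th ->
    ~ zero_soc (foldl (@addI k n) P th) -> homog_in_max c -> nzd P c ->
  exists th', [/\ (size th').+1 = size th, reg (addI P c) th' &
    forall N, socdim (foldl (@addI k n) P th) N <-> socdim (foldl (@addI k n) (addI P c) th') N].
Proof.
move: {2}(size th) (leqnn (size th)) => s.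
elim: s P th c => [|s IH] P [|a [|a2 th]] c //= le_s iP hP rP nz hc nc;
  try by case: nz; apply: nzd_zero_soc nc.
  case: rP => ha na _; exists [::]; split=> // N; split; exact: socdim_exchange.
case: rP => ha na [ha2 na2 rP].
have iPa := addI_ideal a iP; have iPc := addI_ideal c iP.
have hPa := addI_homog_in_max hP ha; have hPc := addI_homog_in_max hP hc.
have zP := nzd_zero_soc iP ha na; have zPa := nzd_zero_soc iPa ha2 na2.
(* [P + (a)] has zero socle because [a2] is regular modulo it; exchanging [a] for [c] carries this
   over to [P + (c)]. *)
have zPc : zero_soc (addI P c).
  by apply/zero_socP; apply: (@socdim_exchange P a) => //; apply/zero_socP.
have [e [d [e_gt0 hd nd]]] : exists e d, [/\ (0 < e)%N, d \is e.-homog &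
    forall Q, List.In Q [:: P; addI P a; addI P c] -> nzd Q d].
  by apply: common_nzd => Q /= [<-|[<-|[<-|[]]]].
have md : homog_in_max d by exists e; rewrite homog_degE.
have ndP : nzd P d by apply: nd; left.
have ndPa : nzd (addI P a) d by apply: nd; right; left.
have ndPc : nzd (addI P c) d by apply: nd; right; right; left.
have [//||g [sg rg gN]] := IH _ (a2 :: th) d _ iPa hPa _ nz md ndPa; first by split.
have iPd := addI_ideal d iP; have hPd := addI_homog_in_max hP md.
have [|||g' [sg' rg' g'N]] := IH _ (a :: g) c _ iPd hPd _ _ hc (nzd_swap iP nc ndPc).
- by rewrite /= sg.
- by rewrite /= addIC; split=> //; apply: nzd_swap ndPa.
- by move=> /= /zero_socP; rewrite addIC -gN => /zero_socP.
exists (d :: g'); split; first by rewrite /= sg' /= sg.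
  by rewrite /= addIC; split.
by move=> N; rewrite gN /= addIC g'N /= addIC.
Qed.

(** Induction on [th'], whose head is brought to the front of the other sequence by [reg_exchange].
    Once [th'] is exhausted the other sequence is empty too, since a further regular element would
    make the socle zero. *)
Lemma socdim_reg P th th' N : ideal P -> homI P -> reg P th -> reg P th' ->
  ~ zero_soc (foldl (@addI k n) P th) -> ~ zero_soc (foldl (@addI k n) P th') ->
  socdim (foldl (@addI k n) P th) N -> socdim (foldl (@addI k n) P th') N.
Proof.
elim: th' P th => [|c th' IH] P th iP hP rth rth' nz nz' Hd.
  case: th rth nz Hd => [//|a th] [ha na _].
  by case: nz'; apply: nzd_zero_soc na.
case: rth' => hc nc rth'.
have [g [_ rg gN]] := reg_exchange iP hP rth nz hc nc.
apply: (IH (addI P c) g) => //; [exact: addI_ideal|exact: addI_homog_in_max| |exact/gN].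
by move/zero_socP/gN/zero_socP.
Qed.

Lemma regular_seq_reg gs th : regular_seq gs th ->
  (forall i, (i < size th)%N -> homog_in_max th`_i) -> reg (in_ideal gs) th.
Proof.
case=> nth _; elim: th gs nth => [//|a th IH] gs nth hth.
split; first exact: (hth 0%N).
  by have := nth 0%N isT; rewrite /= cats0.
rewrite -in_ideal_rcons; apply: IH => [i lt_i|i lt_i]; last exact: (hth i.+1).
by have := nth i.+1 lt_i; rewrite /= -cat_rcons.
Qed.

(** One sequence with nonzero socle decides the type: a maximal sequence also has nonzero socle,
    since otherwise [common_nzd] would prolong it, and [socdim_reg] compares the two. *)
Lemma cm_type_of_reg gs th N : (forall g, g \in gs -> exists d, g \is d.-homog) ->
    regular_seq gs th -> (forall i, (i < size th)%N -> homog_in_max th`_i) ->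
    (0 < N)%N -> socle_dim (gs ++ th) N ->
  cm_type gs N.
Proof.
move=> hgs rth hth N_gt0 dth th' [hth' rth' mth'].
have iP := in_ideal_ideal gs; have hP := in_ideal_hom hgs.
have nz : ~ zero_soc (in_ideal (gs ++ th)).
  case: dth => fs [sfs fs_soc fs_free _] z.
  suff : (1 : k) = 0 by apply/eqP/oner_neq0.
  apply: (fs_free (1 :: nseq N 0) _ 0%N N_gt0).
  case: N N_gt0 sfs fs_soc {fs_free} => // N _ sfs fs_soc.
  rewrite big_ord_recl /= scale1r big1 ?addr0; first exact/z/fs_soc.
  by move=> i _; rewrite -[0 :: _]/(nseq N.+1 (0 : k)) nth_nseq if_same scale0r.
have nz' : ~ zero_soc (in_ideal (gs ++ th')).
  move=> z; have [|e [g [e_gt0 hg ng]]] := @common_nzd k n [:: in_ideal (gs ++ th')].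
    move=> Q [<-|[]]; split=> //; first exact: in_ideal_ideal.
    apply: in_ideal_hom => g; rewrite mem_cat => /orP[/hgs//|/(nthP 0)[i /hth' [d [_ hd]] <-]].
    by exists d; rewrite -homog_degE.
  apply: (mth' g); first by exists e; rewrite homog_degE.
  by apply: ng; left.
rewrite !in_ideal_foldl in nz nz'.
have := @socdim_reg _ th th' N iP hP; rewrite -!in_ideal_foldl; apply=> //.
- exact: regular_seq_reg.
- exact: regular_seq_reg.
- by rewrite in_ideal_foldl.
- by rewrite in_ideal_foldl.
Qed.

End CMType.
(** * Monomial ideals with a block structure *)

Section Monomials.
Variables (k : fieldType) (n : nat).
Local Notation R := {mpoly k[n]}.
Implicit Types (f g h : R) (m : 'X_{1..n}).

Lemma mcoeffXM (i : 'I_n) g m :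
  ('X_i * g)@_m = if m i == 0%N then 0 else g@_(m - U_(i)).
Proof.
rewrite mulrC; case: eqP => [m0|/eqP nz]; last first.
  by rewrite -[in LHS](submK (m := U_(i)) (m' := m)) ?lep1mP // addmC mcoeffMX.
apply/eqP; rewrite mcoeff_eq0 (perm_mem (msuppMX _ _)); apply/mapP => -[m' _ Em].
by move: m0; rewrite Em mnmDE mnm1E eqxx.
Qed.

Lemma msuppXM (i : 'I_n) g m : m \in msupp g -> (m + U_(i))%MM \in msupp ('X_i * g).
Proof. by rewrite !mcoeff_msupp mulrC addmC mcoeffMX. Qed.

Lemma mnm_addl_eq0 (i j : 'I_n) m : ((m + U_(i))%MM j == 0%N) = (m j == 0%N) && (i != j).
Proof. by rewrite mnmDE mnm1E addn_eq0 eqb0. Qed.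

(* [K] is the set of monomials of a monomial ideal.  As long as [m x_i] is
   outside [K], [m x_i / x_j] is again a monomial of [g] outside [K], with a
   larger exponent of [x_i]; so one may assume that [m x_i] lies in [K]. *)
Lemma linear_nzd (K : pred 'X_{1..n}) (i j : 'I_n) g : i != j ->
    (forall m, K m -> K (m + U_(j))%MM) ->
    (forall m, ~~ K m -> K (m + U_(i))%MM -> m i = 0%N /\ ~~ K (m + U_(j))%MM) ->
    (forall m, m \in msupp (('X_i - 'X_j) * g) -> K m) ->
  forall m, m \in msupp g -> K m.
Proof.
move=> neq_ij Kup KP Kg m; apply: contraLR; pose M := \max_(m <- msupp g) m i.
(* Induction on the gap between the exponent of [x_i] in [m] and its maximum over the monomials of
   [g]. *)
have [N] := ubnP (M - m i); elim: N m => [|N IH] m; first by rewrite ltn0.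
rewrite ltnS => le_N nKm; apply/negP => gm.
have gm0 : g@_m != 0 by rewrite -mcoeff_msupp.
have [Kmi | nKmi] := boolP (K (m + U_(i))%MM).
  have [mi0 nKmj] := KP m nKm Kmi.
  (* As [x_i] does not occur in [m], the coefficient of [m x_j] in the product is minus that of [m]
     in [g]. *)
  case/negP: nKmj; apply: Kg; rewrite mcoeff_msupp mulrBl mcoeffB !mcoeffXM.
  by rewrite !mnm_addl_eq0 mi0 eqxx (eq_sym j) neq_ij /= eqxx andbF addmK sub0r oppr_eq0.
have : (('X_i - 'X_j) * g)@_(m + U_(i)) == 0.
  by rewrite mcoeff_eq0; apply: contra nKmi => /Kg.
rewrite mulrBl mcoeffB !mcoeffXM !mnm_addl_eq0 eqxx andbF addmK neq_ij andbT /=.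
have [_|mj] := eqVneq (m j) 0%N; first by rewrite subr0 (negbTE gm0).
rewrite subr_eq0 eq_sym => /eqP gm'.
set m' := (m + U_(i) - U_(j))%MM in gm'.
have m'_supp : m' \in msupp g by rewrite mcoeff_msupp gm'.
have Em' : (m' + U_(j) = m + U_(i))%MM by rewrite submK // lep1mP mnm_addl_eq0 negb_and mj.
have m'i : m' i = (m i).+1.
  have := congr1 (fun q : 'X_{1..n} => q i) Em'; rewrite /= !mnmDE !mnm1E eqxx eq_sym.
  by rewrite (negbTE neq_ij) addn0 addn1.
have leM : (m' i <= M)%N by rewrite /M (big_rem m') //= leq_maxl.
suff : m' \notin msupp g by rewrite m'_supp.
apply: IH.
  by rewrite m'i in leM *; apply: leq_trans le_N; rewrite subnS prednK ?subn_gt0.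
by apply: contra nKmi => /Kup; rewrite Em'.
Qed.

End Monomials.
Section BlockIdeal.
Variables (k : fieldType) (n : nat) (rep : 'I_n -> 'I_n) (GS : seq {set 'I_n}).
Local Notation R := {mpoly k[n]}.
Implicit Types (f g h : R) (m : 'X_{1..n}) (S : seq 'I_n) (A D : {set 'I_n}).

(* [rep] retracts the variables onto the representatives [rep r = r]; every
   generator is either the product of a fibre of [rep], or a product of
   representatives whose fibres have at least two elements. *)
Definition block (r : 'I_n) : {set 'I_n} := [set i | rep i == r].
Definition edge A : bool := [forall i in A, (rep i == i) && (1 < #|block i|)%N].
Definition transversal D : bool := all (fun A => edge A ==> (A :&: D != set0)) GS.
Definition set_gens : seq R := [seq \prod_(i in A) 'X_i | A <- GS].

Hypothesis rep_idem : forall i, rep (rep i) = rep i.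
Hypothesis GSP : forall A, A \in GS -> edge A \/ exists2 r, rep r = r & A = block r.
Hypothesis block_GS : forall r, rep r = r -> block r \in GS.

(** [S] lists the variables already identified with their representatives: [phi S] makes the
    substitution, and [KI S] is the monomial ideal generated by the images of the generators, with
    exponents [mon S A]. *)
Definition nonrep S : Prop := forall i, i \in S -> rep i != i.
Definition rho S (i : 'I_n) : 'I_n := if i \in S then rep i else i.
Definition phi S f : R := f \mPo [tuple 'X_(rho S i) | i < n].
Definition lin (i : 'I_n) : R := 'X_i - 'X_(rep i).
Definition mon S A : 'X_{1..n} := (\sum_(i in A) U_(rho S i))%MM.
Definition inK S m : bool := has (fun A => (mon S A <= m)%MM) GS.
Definition KI S f : Prop := forall m, m \in msupp f -> inK S m.

Lemma inK_up S m m' : (m <= m')%MM -> inK S m -> inK S m'.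
Proof. by move=> le_m /hasP[A GA le_A]; apply/hasP; exists A => //; apply: lepm_trans le_m. Qed.

Lemma KI_ideal S : ideal (KI S).
Proof.
split=> [m|f g Kf Kg m /msuppD_le|h f Kf m /msuppM_le]; first by rewrite msupp0.
  by rewrite mem_cat => /orP[/Kf|/Kg].
by case/allpairsP=> -[m1 m2] /= [_ /Kf Km2 ->]; apply: inK_up Km2; apply: lem_addl.
Qed.

Lemma phiX S i : phi S 'X_i = 'X_(rho S i).
Proof. by rewrite /phi comp_mpolyXU -tnth_nth tnth_mktuple. Qed.

Lemma phi_gen S A : phi S (\prod_(i in A) 'X_i) = 'X_[mon S A].
Proof. by rewrite /phi rmorph_prod -mprodXE; apply: eq_bigr => i _; apply: phiX. Qed.

Lemma KI_in_ideal S f : KI S f -> in_ideal [seq 'X_[mon S A] | A <- GS] f.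
Proof.
have iI := in_ideal_ideal [seq 'X_[mon S A] : R | A <- GS].
move=> Kf; rewrite [f]mpolyE big_seq; apply: ideal_sum => // m /Kf/hasP[A GA le_A].
apply: idealZ => //; rewrite -(submK le_A) mpolyXD; case: iI => _ _; apply.
by apply: mem_in_ideal; apply: map_f.
Qed.

Lemma phi_congr S f : in_ideal (map lin S) (f - phi S f).
Proof.
have iI := in_ideal_ideal (map lin S); case: (iI) => I0 ID IM.
pose Q f := in_ideal (map lin S) (f - phi S f).
have QM g h : Q g -> Q h -> Q (g * h).
  move=> Qg Qh; rewrite /Q /phi rmorphM /= -![_ \mPo _]/(phi S _).
  have -> : g * h - phi S g * phi S h = h * (g - phi S g) + phi S g * (h - phi S h) by ring.
  by apply: ID; apply: IM.
have Q1 : Q 1 by rewrite /Q /phi rmorph1 subrr.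
have QX i : Q 'X_i.
  rewrite /Q phiX /rho; case: ifP => [iS|_]; last by rewrite subrr.
  by apply: mem_in_ideal; apply: map_f.
rewrite /phi comp_mpolyEX {1}[f]mpolyE -sumrB; apply: ideal_sum => // m _.
rewrite -scalerBr; apply: idealZ => //; rewrite -/(phi S _) -/(Q _).
rewrite mpolyXE_id; apply: (big_ind Q) => // i _.
by elim: (m i) => [//|e IH]; rewrite exprS; apply: QM.
Qed.

Lemma rho_rep S i : nonrep S -> rho S (rep i) = rep i.
Proof. by move=> nS; rewrite /rho; case: ifP => // /nS; rewrite rep_idem eqxx. Qed.

Lemma phi_lin S i : nonrep S -> i \in S -> phi S (lin i) = 0.
Proof.
move=> nS iS; rewrite /phi /lin rmorphB /= -![_ \mPo _]/(phi S _) !phiX.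
by rewrite rho_rep // /rho iS subrr.
Qed.

(** [phi S] kills the forms [lin i] and maps the generators to monomials; conversely [f] is
    congruent to [phi S f]. Membership thus becomes a condition on single monomials. *)
Lemma in_ideal_phi S f : nonrep S ->
  in_ideal (set_gens ++ map lin S) f <-> KI S (phi S f).
Proof.
move=> nS; have iK := KI_ideal S; have iI := in_ideal_ideal (set_gens ++ map lin S).
have cong g : in_ideal (set_gens ++ map lin S) (g - phi S g).
  by apply: in_ideal_sub (phi_congr S g) => h hS; apply: mem_in_ideal; rewrite mem_cat hS orbT.
split.
  apply: (@in_ideal_min k n (fun f => KI S (phi S f))).
    case: iK => K0 KD KM; rewrite /phi; split=> [|g h|g h]; rewrite ?rmorph0 ?rmorphD ?rmorphM //.
      exact: KD.
    exact: KM.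
  move=> g; rewrite mem_cat => /orP[/mapP[A GA ->]|/mapP[i iS ->]]; last first.
    by rewrite phi_lin //; case: iK.
  rewrite phi_gen => m; rewrite msuppX inE => /eqP->; apply/hasP; exists A => //.
  exact: lepm_refl.
move=> /KI_in_ideal Kf; apply/(ideal_congr iI (cong f)).
apply: in_ideal_sub Kf => g /mapP[A GA ->]; rewrite -phi_gen.
apply/(ideal_congr iI (cong (\prod_(i in A) 'X_i))).
by apply: mem_in_ideal; rewrite mem_cat; apply/orP; left; apply/mapP; exists A.
Qed.

Lemma monE S A j : mon S A j = #|[set i in A | rho S i == j]|.
Proof.
rewrite mnm_sumE -sum1_card big_mkcond [RHS]big_mkcond; apply: eq_bigr => i _ /=.
by rewrite mnm1E !inE; case: (i \in A) => //=; case: eqP.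
Qed.

Lemma rho_block S i : nonrep S -> rep (rho S i) = rep i.
Proof. by move=> nS; rewrite /rho; case: ifP => // _; rewrite rep_idem. Qed.

Lemma mon_edge S A j : nonrep S -> edge A -> mon S A j = (j \in A).
Proof.
move=> nS /forall_inP eA; rewrite monE.
have -> : [set i in A | rho S i == j] = [set i in A | i == j].
  apply/setP => i; rewrite !inE; case: (boolP (i \in A)) => //= /eA /andP[/eqP ri _].
  by rewrite -ri rho_rep // ri.
case: (boolP (j \in A)) => jA /=; last first.
  by apply: eq_card0 => i; rewrite !inE andbC; case: eqP => // ->; apply/negbTE.
rewrite -(cards1 j); apply: eq_card => i; rewrite !inE andbC.
by case: eqP => // ->; rewrite jA.
Qed.

Lemma mon_block S r j : nonrep S -> rep j != r -> mon S (block r) j = 0%N.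
Proof.
move=> nS nj; rewrite monE; apply: eq_card0 => i; rewrite !inE.
by apply: contraNF nj => /andP[/eqP <- /eqP <-]; rewrite rho_block.
Qed.

Lemma mon_block_rep S r : nonrep S -> rep r = r -> (0 < mon S (block r) r)%N.
Proof.
move=> nS rr; rewrite monE; apply/card_gt0P; exists r.
by rewrite !inE rr eqxx -rr rho_rep // eqxx.
Qed.

Lemma mon_nonrep S A j : nonrep S -> rep j != j -> j \notin S -> mon S A j = (j \in A).
Proof.
move=> nS nj jS; rewrite monE.
have -> : [set i in A | rho S i == j] = [set i in A | i == j].
  apply/setP => i; rewrite !inE /rho; case: (boolP (i \in S)) => // iS.
  congr (_ && _); transitivity false; last first.
    by apply/esym/negbTE; apply: contra jS => /eqP<-.
  by apply/negbTE; apply: contra nj => /eqP<-; rewrite rep_idem.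
case: (boolP (j \in A)) => jA /=; last first.
  by apply: eq_card0 => i; rewrite !inE andbC; case: eqP => // ->; apply/negbTE.
rewrite -(cards1 j); apply: eq_card => i; rewrite !inE andbC.
by case: eqP => // ->; rewrite jA.
Qed.

Lemma inK_step S m i : ~~ inK S m -> inK S (m + U_(i))%MM ->
  exists2 A, A \in GS & (mon S A <= m + U_(i))%MM /\ mon S A i = (m i).+1.
Proof.
move=> nK /hasP[A GA le_A]; exists A => //; split=> //.
apply/eqP; rewrite eqn_leq.
have := mnm_lepP le_A i; rewrite mnmDE mnm1E eqxx addn1 => -> /=.
rewrite ltnNge; apply: contra nK => le_i; apply/hasP; exists A => //.
apply/mnm_lepP => j; have := mnm_lepP le_A j; rewrite mnmDE mnm1E.
by case: eqP => [<-|]; rewrite ?addn0.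
Qed.

(** Checks the hypotheses of [linear_nzd]. A generator involving [i] is the block of [i], so the
    representative [r] already occurs in [m]. An edge has exponent at most 1 at [r], and that block
    at most [m r], so neither reaches the exponent that [inK_step] demands for [m x_r]. *)
Lemma lin_nzd S i : nonrep S -> rep i != i -> i \notin S ->
  nzd_mod (set_gens ++ map lin S) (lin i).
Proof.
move=> nS ni iS f /(in_ideal_phi _ nS) Kf; apply/(in_ideal_phi _ nS).
apply: (linear_nzd (K := inK S) (i := i) (j := rep i)); first by rewrite eq_sym.
- by move=> m; apply/inK_up/lem_addr.
- move=> m nK Ki.
  have [A GA [le_A]] := inK_step nK Ki; rewrite mon_nonrep // => mA.
  have [iA mi] : i \in A /\ m i = 0%N by case: (i \in A) mA => //= -[].
  split=> //; apply/negP => Kr; case: (GSP GA) => [/forall_inP /(_ i iA)|[r rr EA]].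
    by rewrite (negbTE ni).
  have Er : r = rep i by move: iA; rewrite EA inE => /eqP.
  have m_gt : (0 < m r)%N.
    apply: leq_trans (mon_block_rep nS rr) _; rewrite -EA.
    by have := mnm_lepP le_A r; rewrite mnmDE mnm1E Er eq_sym (negbTE ni) addn0.
  have [A' GA' [_ mA']] := inK_step nK Kr; rewrite -Er in mA'.
  case: (GSP GA') => [eA'|[r' rr' EA']].
    by move: mA' m_gt; rewrite mon_edge //; case: (r \in A') => //= -[<-].
  have Er' : r' = r.
    by apply/esym/eqP; rewrite -rr; apply: contraTT isT => /(mon_block nS) E; rewrite EA' E in mA'.
  have := mnm_lepP le_A r; rewrite mnmDE mnm1E Er eq_sym (negbTE ni) addn0 -Er.
  by have -> : A = A' by [rewrite EA' Er' EA]; rewrite mA' ltnn.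
- move: Kf; rewrite /KI /phi /lin rmorphM rmorphB /= -![_ \mPo _]/(phi S _) !phiX rho_rep //.
  by rewrite {1}/rho (negbTE iS).
Qed.

(** * The Artinian reduction and its socle *)

Definition nonreps : seq 'I_n := [seq i <- enum 'I_n | rep i != i].
Definition socmon D : 'X_{1..n} :=
  [multinom if (rep i == i) && (i \notin D) then #|block i|.-1 else 0%N | i < n].

Hypothesis GS_neq0 : forall A, A \in GS -> A != set0.

Lemma nonrepsP : nonrep nonreps.
Proof. by move=> i; rewrite mem_filter => /andP[]. Qed.

Lemma rho_nonreps i : rho nonreps i = rep i.
Proof. by rewrite /rho mem_filter mem_enum andbT; case: eqP. Qed.

Lemma mon_block_nonreps r j : mon nonreps (block r) j = if j == r then #|block r| else 0%N.
Proof.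
rewrite monE; case: eqP => [->|/eqP nj].
  by apply: eq_card => i; rewrite !inE rho_nonreps andbb.
by apply: eq_card0 => i; rewrite !inE rho_nonreps; apply: contraNF nj => /andP[/eqP-> /eqP->].
Qed.

Lemma block_card_gt0 r : rep r = r -> (0 < #|block r|)%N.
Proof. by move=> rr; apply/card_gt0P; exists r; rewrite inE rr. Qed.

Lemma phi_supp f m i : m \in msupp (phi nonreps f) -> rep i != i -> m i = 0%N.
Proof.
move=> + ni; move: m; pose Q g := forall m, m \in msupp g -> m i = 0%N; rewrite -/(Q _).
have QM g h : Q g -> Q h -> Q (g * h).
  by move=> Qg Qh m /msuppM_le/allpairsP[[m1 m2] /= [/Qg E1 /Qh E2 ->]]; rewrite mnmDE E1 E2.
have Q1 : Q 1 by move=> m; rewrite msupp1 inE => /eqP->; rewrite mnm0E.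
rewrite /phi comp_mpolyE; apply: (big_ind Q) => [m|g h Qg Qh m /msuppD_le|m _].
- by rewrite msupp0.
- by rewrite mem_cat => /orP[/Qg|/Qh].
- move=> m' /msuppZ_le; move: m'; apply: (big_ind Q) => // j _.
  elim: (m j) => [|e IH]; first by rewrite expr0.
  rewrite exprS; apply: QM IH; rewrite tnth_mktuple rho_nonreps => m'.
  rewrite msuppX inE => /eqP->; rewrite mnm1E; apply/eqP; rewrite eqb0.
  by apply: contra ni => /eqP<-; rewrite rep_idem.
Qed.

Lemma phi_mon m : (forall i, rep i != i -> m i = 0%N) -> phi nonreps 'X_[m] = 'X_[m].
Proof.
move=> m0; rewrite /phi comp_mpolyX mpolyXE_id; apply: eq_bigr => i _.
rewrite tnth_mktuple rho_nonreps; have [->//|/eqP/m0 ->] := rep i =P i.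
by rewrite !expr0.
Qed.

Lemma socmon_nonrep D i : rep i != i -> socmon D i = 0%N.
Proof. by move=> ni; rewrite mnmE (negbTE ni). Qed.

Lemma edge_rep A r : edge A -> r \in A -> rep r = r /\ (1 < #|block r|)%N.
Proof. by move=> /forall_inP eA /eA /andP[/eqP]. Qed.

(** [D] collects the representatives with exponent other than [|B_r| - 1]. For such [r] only an edge
    can put [m x_r] into the ideal, so [m r = 0], and the rest of this edge has positive exponents,
    hence lies outside [D]: this gives minimality. [D] meets every edge because no edge divides
    [m]. *)
Lemma soc_monomial m :
    (forall i, rep i != i -> m i = 0%N) -> ~~ inK nonreps m ->
    (forall r, rep r = r -> inK nonreps (m + U_(r))%MM) ->
  exists2 D, minset transversal D & m = socmon D.
Proof.
move=> m0 nK Kr; pose D := [set r | (rep r == r) && (m r != #|block r|.-1)].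
have DP r : r \in D -> m r = 0%N /\ exists A, [/\ A \in GS, edge A, r \in A &
    forall j, j \in A -> j != r -> (0 < m j)%N].
  rewrite inE => /andP[/eqP rr nm].
  have [A GA [le_A mA]] := inK_step nK (Kr r rr).
  case: (GSP GA) => [eA|[r' _ EA]].
    move: mA; rewrite mon_edge //; last exact: nonrepsP.
    case: (boolP (r \in A)) => //= rA [<-]; split=> //; exists A; split=> // j jA nj.
    have := mnm_lepP le_A j; rewrite mon_edge //; last exact: nonrepsP.
    by rewrite jA mnmDE mnm1E eq_sym (negbTE nj) addn0.
  move: mA; rewrite EA mon_block_nonreps; case: eqP => // <- E.
  by rewrite E eqxx in nm.
exists D; last first.
  apply/mnmP => i; rewrite mnmE; have [ri|/eqP/m0->//] := rep i =P i.
  case: (boolP (i \in D)) => [/DP[]//|]; rewrite inE ri eqxx /= negbK.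
  by move/eqP.
apply/minsetP; split.
  apply/allP => A GA; apply/implyP => eA; apply: contra nK => /eqP AD0.
  apply/hasP; exists A => //; apply/mnm_lepP => j; rewrite mon_edge //; last exact: nonrepsP.
  case: (boolP (j \in A)) => //= jA.
  have [rj cj] := edge_rep eA jA.
  have : j \notin D.
    by apply: contraT; rewrite negbK => jD; have := in_set0 j; rewrite -AD0 inE jA jD.
  by rewrite inE rj eqxx /= negbK => /eqP->; rewrite -ltnS prednK // ltnW.
move=> B tB sBD; apply/eqP; rewrite eqEsubset sBD; apply/subsetP => r rD.
have [_ [A [GA eA rA mA]]] := DP r rD.
have /set0Pn[j] := implyP (allP tB A GA) eA; rewrite inE => /andP[jA jB].
have [<-//|nj] := eqVneq j r.
by have := mA j jA nj; have [-> _] := DP j (subsetP sBD j jB).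
Qed.

Lemma min_transversalP D r : minset transversal D -> r \in D ->
  exists A, [/\ A \in GS, edge A, r \in A & forall j, j \in A -> j != r -> j \notin D].
Proof.
move=> /minsetP[tD minD] rD; have : ~~ transversal (D :\ r).
  apply/negP => /minD /(_ (subsetDl _ _)) E.
  by move: rD; rewrite -E !inE eqxx.
case/allPn => A GA; rewrite negb_imply negbK => /andP[eA /eqP AD0].
have nA j : j \in A -> j != r -> j \notin D.
  move=> jA nj; apply: contraT; rewrite negbK => jD.
  by have := in_set0 j; rewrite -AD0 !inE jA nj jD.
exists A; split=> //; have /set0Pn[j] := implyP (allP tD A GA) eA.
rewrite inE => /andP[jA jD]; have [<-//|nj] := eqVneq j r.
by have := nA j jA nj; rewrite jD.
Qed.

(** Every edge meets [D], where the exponent is 0, and a block needs one more than [|B_r| - 1]. The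
    factor [x_r] completes the block of [r] when [r] is outside [D], and otherwise a private edge of
    [r], whose other exponents are positive because the blocks involved have at least two
    elements. *)
Lemma socmonP D : minset transversal D ->
  ~~ inK nonreps (socmon D) /\ forall r, rep r = r -> inK nonreps (socmon D + U_(r))%MM.
Proof.
move=> mD; have nL := nonrepsP; split.
  apply/negP => /hasP[A GA /mnm_lepP le_A]; case: (GSP GA) => [eA|[r rr EA]].
    have /minsetP[/allP/(_ A GA)/implyP/(_ eA)/set0Pn[j /setIP[jA jD]] _] := mD.
    by have := le_A j; rewrite mon_edge // jA mnmE jD andbF.
  have := le_A r; rewrite EA mon_block_nonreps eqxx mnmE rr eqxx.
  have := block_card_gt0 rr; case: #|_| => // c _; case: ifP => _; by rewrite ?ltnn.
move=> r rr; apply/hasP; case: (boolP (r \in D)) => rD; last first.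
  exists (block r); first exact: block_GS.
  apply/mnm_lepP => j; rewrite mon_block_nonreps mnmDE mnm1E eq_sym.
  case: eqP => // <-; rewrite mnmE rr eqxx rD /= addn1.
  by have := block_card_gt0 rr; case: #|_|.
have [A [GA eA rA nA]] := min_transversalP mD rD.
exists A => //; apply/mnm_lepP => j; rewrite mon_edge // mnmDE mnm1E.
case: (boolP (j \in A)) => //= jA; have [_|nj] := eqVneq r j; first by rewrite addn1.
have [rj cj] := edge_rep eA jA; rewrite mnmE rj eqxx nA //= 1?eq_sym // addn0.
by rewrite -ltnS prednK // ltnW.
Qed.

Lemma socmon_inj : {in minset transversal &, injective socmon}.
Proof.
suff E D : minset transversal D ->
    D = [set r | (rep r == r) && (socmon D r != #|block r|.-1)].
  by move=> D D' mD mD' /= eqD; rewrite (E D mD) (E D' mD') eqD.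
move=> mD; apply/setP => r; rewrite inE mnmE; case: (boolP (r \in D)) => rD /=.
  have [A [_ eA rA _]] := min_transversalP mD rD; have [rr cr] := edge_rep eA rA.
  by rewrite rr eqxx /= eq_sym -lt0n -ltnS prednK // ltnW.
by case: eqP => //=; rewrite eqxx.
Qed.

Lemma block_regular_seq : regular_seq set_gens (map lin nonreps).
Proof.
have nL := nonrepsP; split=> [i|].
  rewrite size_map => lt_i; have x0 : 'I_n by case: nonreps lt_i.
  rewrite -map_take (nth_map x0) //.
  have Li := mem_nth x0 lt_i.
  have uL : uniq nonreps by rewrite filter_uniq ?enum_uniq.
  apply: lin_nzd; [by move=> j /mem_take/nL|exact: nL|].
  have := uL; rewrite -{1}(cat_take_drop i nonreps) cat_uniq => /and3P[_ /hasPn nh _].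
  by apply: nh; rewrite (drop_nth x0 lt_i) mem_head.
move/(in_ideal_phi _ nL); rewrite /phi rmorph1 => /(_ 0%MM).
rewrite msupp1 inE eqxx => /(_ isT)/hasP[A GA /mnm_lepP le_A].
case: (GSP GA) => [eA|[r rr EA]].
  have /set0Pn[j jA] := GS_neq0 GA.
  by have := le_A j; rewrite mon_edge // jA mnm0E.
by have := le_A r; rewrite mnm0E leqNgt EA mon_block_rep.
Qed.

Lemma lin_homog_in_max i : homog_in_max (lin i).
Proof.
exists 1%N; split=> //; rewrite homog_degE; apply: rpredB; by rewrite dhomogX /= mdeg1.
Qed.

Lemma block_socle_dim :
  socle_dim (set_gens ++ map lin nonreps) #|[set D | minset transversal D]|.
Proof.
have nL := nonrepsP; pose s := enum [set D | minset transversal D].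
set N := #|_|; have sN : size s = N by rewrite /N cardE.
have s_min i : (i < N)%N -> minset transversal (nth set0 s i).
  by move=> lt_i; have := mem_nth set0 (s := s); rewrite sN => /(_ i lt_i); rewrite mem_enum inE.
have fsE i : (i < N)%N -> [seq 'X_[socmon D] : R | D <- s]`_i = 'X_[socmon (nth set0 s i)].
  by move=> lt_i; rewrite (nth_map set0) ?sN.
have phi_comb (cs : seq k) :
    phi nonreps (\sum_(i < N) cs`_i *: [seq 'X_[socmon D] : R | D <- s]`_i)
    = \sum_(i < N) cs`_i *: 'X_[socmon (nth set0 s i)].
  rewrite /phi linear_sum; apply: eq_bigr => i _ /=.
  rewrite linearZ /= -/(phi nonreps _) fsE // phi_mon // => j; exact: socmon_nonrep.
have coef_comb (cs : seq k) i : (i < N)%N ->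
    (\sum_(i < N) cs`_i *: 'X_[socmon (nth set0 s i)])@_(socmon (nth set0 s i)) = cs`_i.
  move=> lt_i; rewrite raddf_sum (bigD1 (Ordinal lt_i)) //= mcoeffZ mcoeffX eqxx mulr1.
  rewrite big1 ?addr0 // => j nj; rewrite mcoeffZ mcoeffX; case: eqP; rewrite ?mulr0 //.
  move/(socmon_inj (s_min j (ltn_ord j)) (s_min i lt_i))/eqP.
  rewrite nth_uniq ?sN ?enum_uniq // => /eqP E.
  by case/eqP: nj; apply: val_inj.
exists [seq 'X_[socmon D] | D <- s]; split.
- by rewrite size_map.
- move=> i lt_i j; apply/(in_ideal_phi _ nL).
  rewrite fsE // /phi rmorphM /= -![_ \mPo _]/(phi nonreps _) phiX rho_nonreps.
  rewrite phi_mon; last by move=> j'; apply: socmon_nonrep.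
  rewrite -mpolyXD => m; rewrite msuppX inE => /eqP->; rewrite addmC.
  by case: (socmonP (s_min i lt_i)) => _; apply; rewrite rep_idem.
- move=> cs /(in_ideal_phi _ nL); rewrite phi_comb => Kc i lt_i.
  apply/eqP; rewrite -(coef_comb cs i lt_i) mcoeff_eq0; apply/negP => /Kc.
  by case: (socmonP (s_min i lt_i)) => /negbTE->.
(* The coefficients are read off from [phi f]: each of its monomials outside the ideal is sent into
   it by every representative, hence is some [socmon D]. *)
move=> f sf; pose g := phi nonreps f; exists [seq g@_(socmon D) | D <- s].
apply/(in_ideal_phi _ nL); rewrite /phi raddfB /= -![_ \mPo _]/(phi nonreps _) phi_comb -/g.
move=> m; rewrite mcoeff_msupp mcoeffB => nz; apply: contraNT nz => nK.
have supp_m : m \in msupp g -> exists2 i, (i < N)%N & m = socmon (nth set0 s i).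
  move=> gm; have [i ni|r rr|D mD ->] := @soc_monomial m _ nK; first exact: phi_supp gm ni.
    have /(in_ideal_phi _ nL) := sf r.
    rewrite /phi rmorphM /= -![_ \mPo _]/(phi nonreps _) phiX rho_nonreps rr => K.
    exact/K/msuppXM.
  have sD : D \in s by rewrite mem_enum inE.
  by exists (index D s); rewrite ?nth_index // -sN index_mem.
have [[i lt_i Em]|no_i] := classic (exists2 i, (i < N)%N & m = socmon (nth set0 s i)).
  by rewrite Em coef_comb // (nth_map set0) ?sN // subrr.
have -> : g@_m = 0 by apply/eqP; rewrite mcoeff_eq0; apply/negP => /supp_m.
rewrite sub0r oppr_eq0 raddf_sum big1 // => i _ /=; rewrite mcoeffZ mcoeffX.
by case: eqP => [Em|_]; [case: no_i; exists i | rewrite mulr0].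
Qed.

Lemma block_cm_type : cm_type set_gens #|[set D | minset transversal D]|.
Proof.
apply: (cm_type_of_reg _ block_regular_seq) block_socle_dim.
- move=> _ /mapP[A _ ->]; exists (mdeg (\sum_(i in A) U_(i))%MM).
  by rewrite mprodXE dhomogX.
- move=> i; rewrite size_map => lt_i; have x0 : 'I_n by case: nonreps lt_i.
  by rewrite (nth_map x0) //; apply: lin_homog_in_max.
apply/card_gt0P; have [|D mD _] := @minset_exists _ transversal setT; last by exists D; rewrite inE.
by apply/allP => A GA; rewrite setIT GS_neq0 ?implybT.
Qed.

End BlockIdeal.
(** * Rooted trees and irredundant covers *)

Section RootedTree.
Variables (T : finType) (adj : rel T).
Hypotheses (adj_sym : ssrbool.symmetric adj) (adj_irr : irreflexive adj)
  (adj_conn : forall x y, connect adj x y)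
  (adj_acyclic : forall s : seq T, uniq s -> (3 <= size s)%N -> ~~ cycle adj s).

(** A path from [y] to [z] avoiding [x] closes up through [x] to a cycle, of length at least 3 if
    [y] and [z] differ. *)
Lemma no_detour x y z : adj x y -> adj x z ->
  connect [rel a b | [&& adj a b, a != x & b != x]] y z -> y = z.
Proof.
move=> xy xz /connectP[p pth Ez]; apply: contraTeq isT => neq_yz.
have neq_yx : y != x by apply: contraTneq xy => ->; rewrite adj_irr.
move: Ez neq_yz; case/shortenP: pth => q pth uq _ Ez neq_yz.
have xq : x \notin y :: q.
  rewrite inE negb_or eq_sym neq_yx /=; apply/negP => x_q.
  have : all (fun b => b != x) q.
    elim: q (y) pth {uq Ez x_q} => //= b q IH a /andP[/and3P[_ _ ->] /IH].
    exact.
  by move/allP/(_ x x_q); rewrite eqxx.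
have := adj_acyclic (s := x :: y :: q); rewrite cons_uniq xq uq => /(_ isT).
have adjq : path adj y q by apply: sub_path pth => a b /and3P[].
have -> : cycle adj (x :: y :: q) by rewrite /= rcons_path xy adjq -Ez adj_sym xz.
case: q Ez {pth uq xq adjq} => [Ez|b q _]; last exact.
by rewrite Ez eqxx in neq_yz.
Qed.

Lemma connect_ball x y : exists t, y \in ball adj t x.
Proof.
have /connectP[p pth ->] := adj_conn x y; exists (size p).
elim/last_ind: p pth => [_|p z IH]; first by rewrite inE.
rewrite rcons_path size_rcons last_rcons /= => /andP[/IH xp pz].
by rewrite inE; apply/orP; right; rewrite inE; apply/exists_inP; exists (last x p).
Qed.

(** [d] is the distance to [r]. A neighbour of [x] that is not farther than [x] descends to [r]
    without meeting [x], so [no_detour] leaves only one, the parent; in particular no neighbour has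
    the depth of [x]. *)
Lemma rooted_depth r : exists d : T -> nat,
  [/\ d r = 0%N, forall x, d x = 0%N -> x = r,
      forall x y, adj x y -> d y = (d x).+1 \/ d x = (d y).+1,
      forall x, (0 < d x)%N -> exists2 y, adj x y & d x = (d y).+1 &
      forall x y z, adj x y -> adj x z -> d x = (d y).+1 -> d x = (d z).+1 -> y = z].
Proof.
pose d x := ex_minn (connect_ball r x); exists d.
have d_ball x t : x \in ball adj t r -> (d x <= t)%N.
  by rewrite /d; case: ex_minnP => s _ + /= => /[apply].
have ball_d x : x \in ball adj (d x) r by rewrite /d; case: ex_minnP.
have d0 : d r = 0%N by apply/eqP; rewrite -leqn0; apply: d_ball; rewrite inE.
have d0P x : d x = 0%N -> x = r by move=> E; have := ball_d x; rewrite E inE => /eqP.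
have dS x y : adj x y -> (d y <= (d x).+1)%N.
  move=> xy; apply: d_ball; rewrite /= inE [X in _ || X]inE; apply/orP; right.
  by apply/exists_inP; exists x.
have dP x : (0 < d x)%N -> exists2 y, adj x y & d x = (d y).+1.
  case E: (d x) => [//|t] _; have := ball_d x; rewrite E /= inE => /orP[/d_ball|].
    by rewrite E ltnn.
  rewrite inE => /exists_inP[y ty yx]; exists y; first by rewrite adj_sym.
  by apply/eqP; rewrite eqSS eqn_leq d_ball // -ltnS -E dS.
have down x : (0 < d x)%N -> forall y, y != x -> (d y <= d x)%N ->
    connect [rel a b | [&& adj a b, a != x & b != x]] y r.
  move=> dx y; have [t] := ubnP (d y); elim: t y => // t IH y; rewrite ltnS => le_t neq_yx le_yx.
  have [/d0P->//|] := posnP (d y); case/dP => y' yy' Ey.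
  have lt_y : (d y' < d x)%N by rewrite -Ey.
  have neq' : y' != x by apply: contraTneq lt_y => ->; rewrite ltnn.
  apply: (@connect_trans _ _ y'); first by apply: connect1; rewrite /= yy' neq_yx.
  by apply: IH => //; [rewrite -Ey|apply: ltnW].
have csym x : connect_sym [rel a b | [&& adj a b, a != x & b != x]].
  by apply: sym_connect_sym => a b /=; rewrite adj_sym [(b != x) && _]andbC.
have uniqP x y z : adj x y -> adj x z -> (0 < d x)%N ->
    (d y <= d x)%N -> (d z <= d x)%N -> y = z.
  move=> xy xz dx ly lz; apply: (no_detour xy xz).
  have ne w : adj x w -> w != x by move=> xw; apply: contraTneq xw => ->; rewrite adj_irr.
  apply: connect_trans (down x dx y (ne _ xy) ly) _.
  by rewrite csym; apply: down => //; apply: ne.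
split=> // [x y xy|x y z xy xz Ey Ez]; last first.
  by apply: (uniqP x) => //; rewrite Ey // -ltnS -Ey Ez.
have yx : adj y x by rewrite adj_sym.
have [lt_xy|lt_yx|E] := ltngtP (d x) (d y).
- by left; apply/eqP; rewrite eqn_leq dS.
- by right; apply/eqP; rewrite eqn_leq dS.
have [dx0|dx] := posnP (d x).
  by have := adj_irr x; rewrite {2}(d0P x dx0) -(d0P y) ?xy // -E.
have [x' xx' Ex'] := dP x dx.
have E' : y = x' by apply: (uniqP x) => //; [rewrite E|rewrite Ex'].
by move: E; rewrite Ex' E' => /eqP; rewrite -[X in _ == X]addn0 -addn1 eqn_add2l.
Qed.

End RootedTree.

(** * Counting irredundant covers in a rooted two-coloured tree *)

Section IrredundantCovers.
Variables (T : finType) (adj : rel T) (col : pred T).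
Implicit Types (X : {set T}) (x y z w : T).

Definition covers X : Prop := forall y, col y -> exists2 x, x \in X & adj x y.
(** One half of a minimal TD-set, with minimality expressed by private neighbours. *)
Definition irr_cover X : Prop :=
  [/\ forall x, x \in X -> ~~ col x, covers X &
      forall x, x \in X -> exists2 y, adj x y & forall z, z \in X -> adj z y -> z = x].

Hypothesis adj_sym : ssrbool.symmetric adj.
Hypothesis adj_col : forall x y, adj x y -> col y = ~~ col x.
Hypothesis nonisolated : forall x, exists y, adj x y.
Hypothesis irr_card : forall X1 X2, irr_cover X1 -> irr_cover X2 -> #|X1| = #|X2|.

Lemma leafP_eq x y z : leaf adj x -> adj x y -> adj x z -> y = z.
Proof.
move=> /cards1P[v Ev] xy xz; have := in_set1 y v; have := in_set1 z v.
by rewrite -Ev !inE xy xz => /esym/eqP-> /esym/eqP->.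
Qed.

Lemma nonleafP x y : ~~ leaf adj x -> exists2 z, adj x z & z != y.
Proof.
move=> nl; have [y' xy'] := nonisolated x.
have c1 : (1 < #|nbhd adj x|)%N.
  rewrite ltn_neqAle eq_sym nl /=; apply/card_gt0P; exists y'; by rewrite inE.
have /card_gt1P[a [b [+ + neq]]] := c1; rewrite !inE => xa xb.
have [Ea|na] := eqVneq a y; last by exists a.
by exists b => //; rewrite eq_sym -Ea.
Qed.

Variables (u : T) (d : T -> nat) (c : T -> T).
Hypotheses (u_even : ~~ col u) (u_nonleaf : ~~ leaf adj u).
Hypotheses (du : d u = 0%N) (d0P : forall x, d x = 0%N -> x = u)
  (d_adj : forall x y, adj x y -> d y = (d x).+1 \/ d x = (d y).+1)
  (d_parent : forall x, (0 < d x)%N -> exists2 y, adj x y & d x = (d y).+1)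
  (d_uniq : forall x y z, adj x y -> adj x z -> d x = (d y).+1 -> d x = (d z).+1 -> y = z).
Hypotheses (c_adj : forall w, odd (d w) -> adj w (c w))
  (c_d : forall w, odd (d w) -> d (c w) = (d w).+1).

Definition par x : T := odflt x [pick y | adj x y && (d x == (d y).+1)].

Lemma parP x : (0 < d x)%N -> adj x (par x) /\ d x = (d (par x)).+1.
Proof.
move=> /d_parent[y xy Ey]; rewrite /par; case: pickP => [z /andP[xz /eqP Ez]//|/(_ y)].
by rewrite xy Ey eqxx.
Qed.

Lemma par_uniq x y : adj x y -> d x = (d y).+1 -> par x = y.
Proof.
move=> xy Ey; have [|xp Ep] := @parP x; first by rewrite Ey.
exact: d_uniq xp xy Ep Ey.
Qed.

Lemma par_c w : odd (d w) -> par (c w) = w.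
Proof. by move=> ow; apply: par_uniq; [rewrite adj_sym c_adj | apply: c_d]. Qed.

Lemma d_col x : odd (d x) = col x.
Proof.
have [t] := ubnP (d x); elim: t x => // t IH x; rewrite ltnS => le_t.
have [dx0|/parP[xp Ep]] := posnP (d x); first by rewrite dx0 (d0P dx0) (negbTE u_even).
by rewrite Ep /= IH -?Ep // (adj_col xp) negbK.
Qed.

(* The covers compared below.  The root [u] is taken according to [a]; a vertex
   at depth 2 is taken if it is the chosen child of a vertex of [W]; deeper
   down an odd vertex takes its chosen child exactly when its parent is not
   taken, so that it is covered exactly once. *)
Fixpoint sel (a : bool) (W : pred T) (j : nat) (x : T) : bool :=
  if j is j'.+1 then
    (c (par x) == x) && (if j' is 0 then W (par x) else ~~ sel a W j' (par (par x)))
  else a.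

Definition greedy (a : bool) (W : pred T) : {set T} :=
  [set x | ~~ odd (d x) && sel a W (d x)./2 x].

Section Greedy.
Variables (a : bool) (W : pred T).
Local Notation X := (greedy a W).

Lemma greedy_root : (u \in X) = a.
Proof. by rewrite inE du. Qed.

Lemma greedy_even x : x \in X -> ~~ odd (d x).
Proof. by rewrite inE => /andP[]. Qed.

Lemma greedy_2 x : d x = 2%N -> (x \in X) = (c (par x) == x) && W (par x).
Proof. by move=> Ex; rewrite inE Ex. Qed.

Lemma greedy_4 x : (2 < d x)%N -> ~~ odd (d x) ->
  (x \in X) = (c (par x) == x) && (par (par x) \notin X).
Proof.
move=> lt_x ex; have [_ Ep] := parP (ltnW (ltnW lt_x)).
have [|_ Epp] := @parP (par x); first by rewrite -ltnS -Ep ltnW.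
have epp : ~~ odd (d (par (par x))) by move: ex; rewrite Ep Epp /= negbK.
rewrite !inE ex epp Ep Epp /=; move: lt_x epp; rewrite Ep Epp.
by case: (d (par (par x))) => [|[|e]].
Qed.

(** The chosen child of [y] is rejected because [x] is taken; at the root this is the assumption on
    [W]. *)
Lemma child_private x y : d y = (d x).+1 -> adj x y -> ~~ odd (d x) -> x \in X ->
  (x = u -> ~~ W y) -> forall z, z \in X -> adj z y -> z = x.
Proof.
move=> Ey xy ex xX nW z zX zy; have py : par y = x by apply: par_uniq; rewrite // adj_sym.
case: (d_adj zy) => [Ez|Ez]; first by rewrite -py; apply/esym/par_uniq; rewrite // adj_sym.
have pz : par z = y by apply: par_uniq.
have [dx0|dx] := posnP (d x).
  have dz : d z = 2 by rewrite Ez Ey dx0.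
  by move: zX; rewrite greedy_2 // pz (negbTE (nW (d0P dx0))) andbF.
move: (zX); rewrite greedy_4 ?(greedy_even zX) //; last by rewrite Ez Ey.
by rewrite pz py xX andbF.
Qed.

(** The parent of [x] is not covered from above, and from below only by its chosen child, which is
    [x]. *)
Lemma parent_private x : x \in X -> (0 < d x)%N -> par (par x) \notin X ->
  forall z, z \in X -> adj z (par x) -> z = x.
Proof.
move=> xX dx npp z zX zp; have [xp Ep] := parP dx.
have ce z' : z' \in X -> (1 < d z')%N -> c (par z') = z'.
  move=> z'X; rewrite leq_eqVlt => /predU1P[/esym E|lt_z].
    by move: z'X; rewrite greedy_2 // => /andP[/eqP].
  by move: (z'X); rewrite greedy_4 ?(greedy_even z'X) // => /andP[/eqP].
have odd_p : odd (d (par x)) by have := greedy_even xX; rewrite Ep /= negbK.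
case: (d_adj zp) => Ez.
  have Ezp : par (par x) = z by apply: par_uniq; rewrite // adj_sym.
  by rewrite Ezp zX in npp.
have dp : (0 < d (par x))%N by case: (d (par x)) odd_p.
by rewrite -(ce z zX) ?Ez // (par_uniq zp Ez) ce // Ep.
Qed.

(** The hypotheses concern the root. Its neighbours must be covered; if it is taken it needs a
    private neighbour, and a taken [c y], whose parent the root also covers, needs a private child
    and so must not be a leaf. *)
Lemma greedy_irr :
    (forall y, adj u y -> a || W y) ->
    (a -> exists2 y, adj u y & ~~ W y) ->
    (a -> forall y, adj u y -> W y -> ~~ leaf adj (c y)) ->
  irr_cover X.
Proof.
move=> Hcov Hroot Hnl; split=> [x /greedy_even|y|x xX]; first by rewrite d_col.
  rewrite -d_col => oy; have dy : (0 < d y)%N by case: (d y) oy.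
  have [yp Ep] := parP dy; have py : adj (par y) y by rewrite adj_sym.
  have cy : adj (c y) y by rewrite adj_sym c_adj.
  have [dp0|dp] := posnP (d (par y)).
    have Eu : par y = u by apply: d0P.
    have := Hcov y; rewrite -Eu => /(_ py) /orP[a1|Wy].
      by exists (par y) => //; rewrite Eu greedy_root.
    exists (c y) => //; rewrite greedy_2 ?par_c ?eqxx //.
    by rewrite c_d // Ep dp0.
  have [pX|npX] := boolP (par y \in X); first by exists (par y).
  exists (c y) => //; rewrite greedy_4 ?c_d /= ?oy //; first by rewrite par_c // eqxx.
  by rewrite Ep !ltnS.
have ex := greedy_even xX; have [dx0|dx] := posnP (d x).
  have Eu := d0P dx0; have a1 : a by rewrite -greedy_root -Eu.
  have [y uy nW] := Hroot a1; exists y; first by rewrite Eu.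
  apply: (child_private _ _ ex xX) => //; last by rewrite Eu.
  by rewrite Eu; case: (d_adj uy) => //; rewrite du.
have [xp Ep] := parP dx; have dx1 : (1 < d x)%N by case: (d x) ex dx => [|[]].
have [pX|npX] := boolP (par (par x) \in X); last first.
  by exists (par x) => //; apply: parent_private.
(* By [greedy_4] a taken grandparent occurs only at depth 2; it is the root, and the private
   neighbour of [x] is sought among its children. *)
have dx2 : d x = 2%N.
  move: dx1; rewrite leq_eqVlt => /predU1P[//|lt_x].
  by move: xX; rewrite greedy_4 // pX andbF.
have dp : d (par x) = 1%N by move: dx2; rewrite Ep => -[].
have [|pp Epp] := @parP (par x); first by rewrite dp.
have ppu : par (par x) = u by apply: d0P; move: Epp; rewrite dp => -[].
have a1 : a by rewrite -greedy_root -ppu.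
move: (xX); rewrite greedy_2 // => /andP[/eqP Ex Wp].
have := Hnl a1 (par x); rewrite adj_sym -{1}ppu => /(_ pp Wp); rewrite Ex => nl.
have [y xy ny] := nonleafP (par x) nl; exists y => //.
case: (d_adj xy) => Ey; last by rewrite (par_uniq xy Ey) eqxx in ny.
apply: child_private => // Eu; by rewrite Eu du in dx2.
Qed.

End Greedy.

Definition anc x : T := iter (d x).-1 par x.

Lemma anc1 x : d x = 1%N -> anc x = x.
Proof. by rewrite /anc => ->. Qed.

Lemma anc_par x : (1 < d x)%N -> anc x = anc (par x).
Proof.
move=> dx; have [_ Ep] := parP (ltnW dx); rewrite /anc Ep -iterSr /=.
by case: (d (par x)) Ep => // Ep; rewrite Ep in dx.
Qed.

Lemma anc_adj x : (0 < d x)%N -> adj u (anc x).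
Proof.
have [t] := ubnP (d x); elim: t x => // t IH x; rewrite ltnS => le_t dx.
have [xp Ep] := parP dx; have [dp0|dp] := posnP (d (par x)).
  rewrite anc1; last by rewrite Ep dp0.
  by rewrite -(d0P dp0) adj_sym.
rewrite anc_par; last by rewrite Ep ltnS.
by apply: IH => //; rewrite -Ep.
Qed.

Definition branch (a : bool) (W : pred T) w : nat :=
  #|[set x in greedy a W | (x != u) && (anc x == w)]|.

Lemma card_greedy a W : #|greedy a W| = (a + \sum_(w in nbhd adj u) branch a W w)%N.
Proof.
rewrite (cardsD1 u) greedy_root; congr (_ + _)%N.
rewrite -sum1_card (partition_big anc (mem (nbhd adj u))) /=; last first.
  move=> x; rewrite !inE => /andP[nx _]; apply: anc_adj.
  by rewrite lt0n; apply: contra nx => /eqP/d0P->.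
apply: eq_bigr => w _; rewrite sum1_card; apply: eq_card => x.
by rewrite !inE -!topredE /= !inE; case: (x == u) => //=; rewrite ?andbF // andbT.
Qed.

(** Selection looks back through grandparents to depth 2, where only the value of [W] at the
    ancestor counts; so the branches at the root are independent. *)
Lemma greedy_branch a a' (W W' : pred T) x : W (anc x) = W' (anc x) -> x != u ->
  (x \in greedy a W) = (x \in greedy a' W').
Proof.
have [t] := ubnP (d x); elim: t x => // t IH x; rewrite ltnS => le_t EW nx.
have dx : (0 < d x)%N by rewrite lt0n; apply: contra nx => /eqP/d0P->.
have [ox|ex] := boolP (odd (d x)); first by rewrite !inE ox.
have dx1 : (1 < d x)%N by case: (d x) ex dx => [|[]].
have [xp Ep] := parP dx; have dp : (0 < d (par x))%N by rewrite -ltnS -Ep.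
have [pp Epp] := parP dp.
move: dx1; rewrite leq_eqVlt => /predU1P[/esym dx2|lt_x].
  have dp1 : d (par x) = 1%N by move: dx2; rewrite Ep => -[].
  by rewrite !greedy_2 // -(anc1 dp1) -anc_par ?dx2 // EW.
have dpp : (0 < d (par (par x)))%N by rewrite -ltnS -ltnS -Epp -Ep.
rewrite (@greedy_4 a W x) // (@greedy_4 a' W' x) // IH //.
- by apply: leq_trans le_t; rewrite Ep Epp ltnS.
- by rewrite -anc_par ?Epp // -anc_par // ltnW.
- by apply: contraTneq dpp => ->; rewrite du.
Qed.

Lemma branch_eq a a' (W W' : pred T) w : W w = W' w -> branch a W w = branch a' W' w.
Proof.
move=> EW; apply: eq_card => x; rewrite !inE.
case: (x =P u) => [|/eqP nx]; first by rewrite !andbF.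
case: eqP => [Ew|]; last by rewrite !andbF.
have := @greedy_branch a a' W W' x; rewrite Ew => /(_ EW nx).
by rewrite !inE => ->.
Qed.

(** A leaf [c w] has no descendants, so taking it changes nothing else in the branch. *)
Lemma branch_leaf a a' (W W' : pred T) w : adj u w -> leaf adj (c w) -> W w -> ~~ W' w ->
  branch a W w = (branch a' W' w).+1.
Proof.
move=> uw lc Ww nW'w.
have dw : d w = 1%N by case: (d_adj uw); rewrite du.
have ow : odd (d w) by rewrite dw.
have dc : d (c w) = 2%N by rewrite c_d // dw.
have pc := par_c ow.
have nc : c w != u by apply/eqP => E; rewrite E du in dc.
have ac : anc (c w) = w by rewrite anc_par ?dc // pc anc1.
rewrite /branch (cardsD1 (c w)) !inE nc ac eqxx dc /= pc eqxx Ww /=.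
congr _.+1; apply: eq_card => x; rewrite !inE.
case: (x =P c w) => [->|/eqP nx] /=.
  by rewrite dc /= pc (negbTE nW'w) andbF.
case: (x =P u) => [|/eqP nu]; first by rewrite !andbF.
case: eqP => [Ew|]; last by rewrite !andbF.
suff : (x \in greedy a W) = (x \in greedy a' W') by rewrite !inE => ->.
have [t] := ubnP (d x); elim: t x nx nu Ew => // t IH x nx nu Ew; rewrite ltnS => le_t.
have dx : (0 < d x)%N by rewrite lt0n; apply: contra nu => /eqP/d0P->.
have [ox|ex] := boolP (odd (d x)); first by rewrite !inE ox.
have dx1 : (1 < d x)%N by case: (d x) ex dx => [|[]].
have [xp Ep] := parP dx; have dp : (0 < d (par x))%N by rewrite -ltnS -Ep.
have [pp Epp] := parP dp.
move: dx1; rewrite leq_eqVlt => /predU1P[/esym dx2|lt_x].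
  have dp1 : d (par x) = 1%N by move: dx2; rewrite Ep => -[].
  have Epw : par x = w by rewrite -Ew -(anc1 dp1) -anc_par ?dx2.
  by rewrite !greedy_2 // Epw eq_sym (negbTE nx).
have dpp : (0 < d (par (par x)))%N by rewrite -ltnS -ltnS -Epp -Ep.
rewrite (@greedy_4 a W x) // (@greedy_4 a' W' x) // IH //.
- apply: contraTneq lc => Epc; apply/negP => lc.
  have [|ppp Eppp] := @parP (par (par x)); first by [].
  have Exy : par x = par (par (par x)).
    apply: leafP_eq ppp; first by rewrite Epc.
    by rewrite adj_sym.
  by move: Epp; rewrite Eppp -Exy => /eqP; rewrite -[X in X == _]addn0 -[_.+2]addn2 eqn_add2l.
- by apply: contraTneq dpp => ->; rewrite du.
- by rewrite -anc_par ?Epp // -anc_par // ltnW.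
- by apply: leq_trans le_t; rewrite Ep Epp ltnS.
Qed.

(* All the greedy covers used here have the same size.  Writing [s w] and [t w]
   for the size of the branch at [w] when [c w] is rejected, resp. taken, this
   gives [1 + sum s = sum t], and [t w = s w] when [c w] is not a leaf, while
   [t w = s w + 1] when it is. *)
Lemma leaf_children : #|[set w in nbhd adj u | leaf adj (c w)]| = 1%N.
Proof.
have [w0 uw0] := nonisolated u.
have irr1 : irr_cover (greedy true pred0) by apply: greedy_irr => // _; exists w0.
have irr0 : irr_cover (greedy false predT) by apply: greedy_irr.
have stepE w : adj u w -> branch false predT w = (branch true pred0 w + leaf adj (c w))%N.
  move=> uw; case: (boolP (leaf adj (c w))) => lc; first by rewrite addn1; apply: branch_leaf.
  have irrw : irr_cover (greedy true (pred1 w)).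
    apply: greedy_irr => // [_|_ y _ /eqP->//].
    by have [y uy ny] := nonleafP w u_nonleaf; exists y.
  have := irr_card irrw irr1; rewrite !card_greedy => /addnI.
  rewrite (bigD1 w) ?inE //= [RHS](bigD1 w) ?inE //=.
  rewrite (eq_bigr (branch true pred0)); last first.
    by move=> y /andP[_ ny]; apply: branch_eq; rewrite /= (negbTE ny).
  move/addIn; rewrite addn0 => <-; apply: branch_eq; by rewrite /= eqxx.
have := irr_card irr0 irr1; rewrite !card_greedy add0n.
rewrite (eq_bigr (fun w => branch true pred0 w + leaf adj (c w))%N); last first.
  by move=> w; rewrite inE => /stepE.
rewrite big_split /= addnC => /addIn E1; apply: etrans E1; rewrite -sum1_card.
rewrite big_mkcond [RHS]big_mkcond; apply: eq_bigr => w _ /=.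
by rewrite !inE; case: (adj u w) => //=; case: (leaf _ _).
Qed.

End IrredundantCovers.
(** * Unmixed balanced trees *)

Section Heights.
Variables (T : finType) (adj : rel T).
Implicit Types (u v w x y z : T).

Lemma ball_le v s t : (s <= t)%N -> ball adj s v \subset ball adj t v.
Proof.
elim: t => [|t IH]; first by rewrite leqn0 => /eqP->.
rewrite leq_eqVlt => /predU1P[->//|/IH sub]; apply: subset_trans sub _.
exact: subsetUl.
Qed.

Lemma ball_adj u v t : adj u v -> ball adj t v \subset ball adj t.+1 u.
Proof.
move=> uv; elim: t => [|t IH].
  rewrite sub1set /= inE; apply/orP; right; rewrite inE; apply/exists_inP.
  by exists u; rewrite ?inE.
rewrite [ball adj t.+1 v]/= subUset (subset_trans IH) ?ball_le //=.
apply/subsetP => x; rewrite inE => /exists_inP[y yv yx]; rewrite inE; apply/orP; right.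
by rewrite inE; apply/exists_inP; exists y => //; apply: (subsetP IH).
Qed.

Lemma height_le t v z : z \in ball adj t v -> leaf adj z -> (height adj v <= t)%N.
Proof.
move=> tz lz; rewrite /height; case: ifP => // _.
have [lt_t|le_t] := ltnP t #|T|; last first.
  by apply: leq_trans (find_size _ _) _; rewrite size_iota.
rewrite leqNgt; apply/negP => /(before_find 0%N); rewrite nth_iota // add0n.
by move/exists_inPn/(_ z tz); rewrite lz.
Qed.

(** [find] returns [#|T|] when the search fails, so a height below [#|T|] comes with a leaf. *)
Lemma height_ball v : [exists u, leaf adj u] -> (height adj v < #|T|)%N ->
  exists2 z, z \in ball adj (height adj v) v & leaf adj z.
Proof.
move=> hl; rewrite /height hl; set P := (fun t => _) => lt_h.
have /(nth_find 0%N) : has P (iota 0 #|T|) by rewrite has_find size_iota.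
by rewrite nth_iota // add0n => /exists_inP.
Qed.

Lemma height_adj u v : adj u v -> (height adj u <= (height adj v).+1)%N.
Proof.
move=> uv; case: (boolP [exists u, leaf adj u]) => [hl|/negbTE nl]; last first.
  by rewrite /height nl.
have [lt_h|le_h] := ltnP (height adj v) #|T|.
  have [z vz lz] := height_ball hl lt_h.
  by apply: height_le lz; apply: (subsetP (ball_adj _ uv)).
apply: leq_trans (leqW le_h); rewrite /height hl.
by apply: leq_trans (find_size _ _) _; rewrite size_iota.
Qed.

End Heights.

Section UnmixedBalancedTree.
Variables (T : finType) (adj : rel T).
Implicit Types (u v w x y z : T).
Hypotheses (treeT : is_tree adj) (unm : unmixed adj) (bal : balanced adj).
Variables (a0 b0 : T).
Hypothesis edge0 : adj a0 b0.

Local Notation ht := (height adj).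

Lemma tree_sym : ssrbool.symmetric adj. Proof. by case: treeT. Qed.
Lemma tree_irr : irreflexive adj. Proof. by case: treeT. Qed.

Lemma has_leaf : [exists u, leaf adj u].
Proof.
by apply: contraT => /negbTE nl; have := bal edge0; rewrite /height nl eqxx.
Qed.

Lemma card_gt1T : (1 < #|T|)%N.
Proof.
apply/card_gt1P; exists a0, b0; split=> //.
by apply: contraTneq edge0 => ->; rewrite tree_irr.
Qed.

Lemma tree_nbr x : exists y, adj x y.
Proof.
have [->|neq] := eqVneq x a0; first by exists b0.
case: treeT => _ _ _ conn _; have /connectP[p pth E] := conn x a0.
by case: p pth E => [_ E|y p /andP[xy _] _]; [rewrite E eqxx in neq | exists y].
Qed.

Lemma height0P v : (ht v == 0%N) = leaf adj v.
Proof.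
apply/eqP/idP => [h0|lv]; last by apply/eqP; rewrite -leqn0 (height_le _ lv) // inE.
have [|z] := height_ball has_leaf (v := v); first by rewrite h0 ltnW // card_gt1T.
by rewrite h0 inE => /eqP->.
Qed.

Lemma leaf_nbr_height u v : leaf adj u -> adj u v -> ht v = 1%N.
Proof.
move=> lu uv; have vu : adj v u by rewrite tree_sym.
have := height_adj vu; have := bal uv; move: lu; rewrite -height0P => /eqP->.
by case: (ht v) => [|[]].
Qed.

Lemma height1_leaf v : ht v = 1%N -> exists2 z, adj v z & leaf adj z.
Proof.
move=> h1; have [|z] := height_ball has_leaf (v := v); first by rewrite h1 card_gt1T.
rewrite h1 /= inE => /orP[|] vz lz.
  by move: lz; rewrite inE in vz; rewrite (eqP vz) -height0P h1.
by exists z => //; move: vz; rewrite inE => /exists_inP[y]; rewrite inE => /eqP->.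
Qed.

(** Heights of neighbours differ by at most 1 and, by balancedness, are not equal. *)
Lemma adj_odd u v : adj u v -> odd (ht v) = ~~ odd (ht u).
Proof.
move=> uv; have vu : adj v u by rewrite tree_sym.
have [lt_uv|lt_vu|E] := ltngtP (ht u) (ht v).
- by have -> : ht v = (ht u).+1 by apply/eqP; rewrite eqn_leq lt_uv height_adj.
- have -> : ht u = (ht v).+1 by apply/eqP; rewrite eqn_leq lt_vu height_adj.
  by rewrite /= negbK.
by have := bal uv; rewrite E eqxx.
Qed.

Local Notation oddv := (fun v => odd (ht v)).

(** Joining either cover to one fixed minimal cover [E] of the even vertices gives a minimal TD-set,
    since adjacency flips parity and the two halves do not interact; unmixedness compares the
    sizes. *)
Lemma odd_cover_card (X1 X2 : {set T}) :
  irr_cover adj oddv X1 -> irr_cover adj oddv X2 -> #|X1| = #|X2|.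
Proof.
pose covE (E : {set T}) := Veven adj \subset nbhdS adj E.
have [|E mE _] := @minset_exists _ covE setT.
  apply/subsetP => v _; have [y vy] := tree_nbr v.
  by rewrite inE; apply/exists_inP; exists y; rewrite ?inE // tree_sym.
have /minsetP[cE minE] := mE.
have EP x : x \in E -> exists v, [/\ adj x v, ~~ odd (ht v) & forall z, z \in E -> adj z v -> z = x].
  move=> xE; have : ~~ covE (E :\ x).
    apply/negP => /minE /(_ (subsetDl _ _)) eqE.
    by move: xE; rewrite -eqE !inE eqxx.
  case/subsetPn => v; rewrite inE => ev; rewrite inE => /exists_inPn nv.
  have priv z : z \in E -> adj z v -> z = x.
    move=> zE zv; apply/eqP; apply: contraT => nzx.
    by have := nv z; rewrite !inE nzx zE zv => /(_ isT).
  have := subsetP cE v; rewrite inE ev => /(_ isT); rewrite inE => /exists_inP[z zE zv].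
  by exists v; split=> //; rewrite -(priv z zE zv).
have E_odd x : x \in E -> odd (ht x).
  by move=> /EP[v [xv ev _]]; rewrite (adj_odd (u := v)) // tree_sym.
suff TD X : irr_cover adj oddv X -> minset (is_TD adj) (X :|: E) /\ #|X :|: E| = (#|X| + #|E|)%N.
  move=> /TD[m1 c1] /TD[m2 c2]; have := unm m1 m2; rewrite c1 c2; exact: addIn.
case=> X_even X_cov X_priv; split; last first.
  rewrite cardsU disjoint_setI0 ?cards0 ?subn0 //; apply/pred0P => x /=.
  by apply/negP => /andP[/X_even nx /E_odd]; rewrite (negbTE nx).
apply/minsetP; split.
  apply/eqP/setP => v; rewrite !inE; apply/exists_inP.
  case: (boolP (odd (ht v))) => ov.
    by have [x xX xv] := X_cov v ov; exists x; rewrite // inE xX.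
  have := subsetP cE v; rewrite inE ov => /(_ isT); rewrite inE => /exists_inP[z zE zv].
  by exists z; rewrite // inE zE orbT.
move=> B /eqP tB sB; apply/eqP; rewrite eqEsubset sB; apply/subsetP => x.
have dom v : exists2 z, z \in B & adj z v.
  by have := in_setT v; rewrite -tB inE => /exists_inP.
rewrite inE => /orP[xX|xE].
  have [y xy priv] := X_priv x xX; have [z zB zy] := dom y.
  have := subsetP sB z zB; rewrite inE => /orP[zX|/E_odd oz]; first by rewrite -(priv z zX zy).
  by move: (X_even x xX); rewrite -(negbK (odd _)) -(adj_odd xy) (adj_odd zy) oz.
have [v [xv ev priv]] := EP x xE; have [z zB zv] := dom v.
have := subsetP sB z zB; rewrite inE => /orP[/X_even oz|zE]; last by rewrite -(priv z zE zv).
by move: ev; rewrite (adj_odd zv) oz.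
Qed.

(** In the tree rooted at [u], [c w] is a child satisfying [pref] if there is one. The count holds
    for every choice of children, so different preferences yield different information. *)
Lemma chosen_leaf (pref : pred T) u : ~~ odd (ht u) -> ~~ leaf adj u ->
  exists c : T -> T,
    [/\ forall w, adj u w -> adj w (c w) /\ c w != u,
        forall w z, adj u w -> adj w z -> z != u -> pref z -> pref (c w) &
        #|[set w in nbhd adj u | leaf adj (c w)]| = 1%N].
Proof.
move=> eu nlu; case: treeT => _ _ _ conn acyc.
have [d [du d0P d_adj d_par d_uniq]] := rooted_depth tree_sym tree_irr conn acyc u.
pose child w z := adj w z && (d z == (d w).+1).
pose c w := odflt (odflt w [pick z | child w z]) [pick z | child w z && pref z].
have d_odd x : odd (d x) = odd (ht x).
  exact: (@d_col T adj oddv adj_odd u d eu d0P d_par).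
have child_ex w : odd (d w) -> exists z, child w z.
  move=> ow; have nlw : ~~ leaf adj w.
    by rewrite -height0P; apply: contraTneq ow => h0; rewrite d_odd h0.
  have [|y wy Ey] := d_par w; first by case: (d w) ow.
  have [z wz nz] := nonleafP tree_nbr y nlw; exists z.
  rewrite /child wz; case: (d_adj _ _ wz) => [->|Ez]; first by rewrite eqxx.
  by move: nz; rewrite (d_uniq w z y wz wy Ez Ey) eqxx.
have cP w : odd (d w) -> child w (c w).
  move=> /child_ex[z wz]; rewrite /c.
  case: (pickP (fun z => child w z && pref z)) => [z1 /andP[]//|_] /=.
  by case: pickP => [z1 cz1|/(_ z)]; [exact: cz1 | rewrite wz].
exists c; split.
- move=> w uw; have dw : d w = 1%N by case: (d_adj _ _ uw); rewrite du.
  have /andP[wc /eqP dc] : child w (c w) by apply: cP; rewrite dw.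
  by split=> //; apply: contraTneq isT => E; move: dc; rewrite E du.
- move=> w z uw wz nzu pz; have dw : d w = 1%N by case: (d_adj _ _ uw); rewrite du.
  rewrite /c; case: (pickP (fun z => child w z && pref z)) => [z1 /andP[]//|/(_ z)].
  rewrite /child wz pz andbT.
  case: (d_adj _ _ wz) => [->|Ez]; rewrite ?eqxx //.
  by move: nzu; rewrite (d0P z) ?eqxx //; move: Ez; rewrite dw => -[].
apply: (leaf_children tree_sym adj_odd tree_nbr odd_cover_card eu nlu du d0P d_adj d_par d_uniq).
  by move=> w /cP/andP[].
by move=> w /cP/andP[_ /eqP].
Qed.

(** When leaves are preferred, [c w] is a leaf exactly for the neighbours [w] of height 1, and the
    count is 1. *)
Lemma height1_nbr_uniq u : ~~ odd (ht u) ->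
  exists2 w, adj u w /\ ht w = 1%N & forall w', adj u w' -> ht w' = 1%N -> w' = w.
Proof.
move=> eu; case: (boolP (leaf adj u)) => [lu|nlu].
  have [w uw] := tree_nbr u; exists w; first by split=> //; apply: leaf_nbr_height uw.
  by move=> w' uw' _; apply: leafP_eq lu uw' uw.
have [c [cP pref]] := chosen_leaf (leaf adj) eu nlu.
have cE w : adj u w -> leaf adj (c w) = (ht w == 1%N).
  move=> uw; have [wc _] := cP w uw; apply/idP/eqP => [lc|/height1_leaf[z wz lz]].
    by apply: leaf_nbr_height lc _; rewrite tree_sym.
  by apply: (pref w z) => //; apply: contraTneq lz => ->.
case/eqP/cards1P => w Ew; have := in_set1 w w; rewrite -Ew eqxx !inE => /andP[uw lw].
exists w; first by split=> //; apply/eqP; rewrite -cE.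
by move=> w' uw' h1; apply/eqP; rewrite -in_set1 -Ew !inE uw' cE // h1.
Qed.

(** Prefer non-leaves in the tree rooted at [u]. The neighbour [v] with leaf [c v] has height 1,
    hence is [w]; but a second non-leaf next to [w] would have been preferred. *)
Lemma height1_nonleaf_uniq w u u' : ht w = 1%N -> adj w u -> adj w u' ->
  ~~ leaf adj u -> ~~ leaf adj u' -> u = u'.
Proof.
move=> hw wu wu' nlu nlu'; apply/eqP; apply: contraT => neq.
have uw : adj u w by rewrite tree_sym.
have eu : ~~ odd (ht u) by rewrite (adj_odd wu) hw.
have [c [cP pref]] := chosen_leaf (fun z => ~~ leaf adj z) eu nlu.
case/eqP/cards1P => v Ev; have := in_set1 v v; rewrite -Ev eqxx !inE => /andP[uv lv].
have [w1 _ uniq] := height1_nbr_uniq eu.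
have [vc _] := cP v uv; have hv : ht v = 1%N by apply: leaf_nbr_height lv _; rewrite tree_sym.
have Evw : v = w by rewrite (uniq v) // (uniq w).
by have := pref w u' uw wu'; rewrite eq_sym neq nlu' -Evw lv => /(_ isT isT).
Qed.

(** An even neighbour of [v] is itself next to a vertex of height 1, so its height is at most 2. *)
Lemma odd_height v : odd (ht v) -> ht v = 1%N \/ ht v = 3%N.
Proof.
move=> ov; have [u vu] := tree_nbr v.
have eu : ~~ odd (ht u) by rewrite (adj_odd vu) ov.
have [w [uw hw] _] := height1_nbr_uniq eu.
have := height_adj uw; have := height_adj vu; rewrite hw.
move=> h1 h2; have : (ht v <= 3)%N by apply: leq_trans h1 _; rewrite ltnS.
by case: (ht v) ov => [|[|[|[|]]]] //; [left|right].
Qed.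

End UnmixedBalancedTree.
(** * The ideal of the odd neighbourhoods *)

Section NoddIdeal.
Variables (k : fieldType) (T : finType) (adj : rel T) (n : nat) (e : 'I_n -> T).
Hypotheses (treeT : is_tree adj) (unm : unmixed adj) (bal : balanced adj).
Hypotheses (e_inj : injective e) (e_even : forall v, v \in Veven adj <-> exists i, e i = v).
Variables (a0 b0 : T).
Hypothesis edge0 : adj a0 b0.

Local Notation ht := (height adj).
Local Notation sym := (tree_sym treeT).
Local Notation flip := (adj_odd treeT bal).

Lemma e_ht i : ~~ odd (ht (e i)).
Proof. by have /e_even : exists j, e j = e i by [exists i]; rewrite inE. Qed.

Lemma e_surj v : ~~ odd (ht v) -> exists i, e i = v.
Proof. by move=> ev; apply/e_even; rewrite inE. Qed.

(* The blocks are the neighbourhoods of the vertices of height 1; the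
   representative of a block is its vertex of height 2, if there is one. *)
Definition stem (v : T) : T := odflt v [pick w | adj v w && (ht w == 1%N)].

Definition core (w : T) : T :=
  odflt (odflt w [pick u | adj w u]) [pick u | adj w u && ~~ leaf adj u].

Definition rep (i : 'I_n) : 'I_n := odflt i [pick j | e j == core (stem (e i))].

Lemma stemP v : ~~ odd (ht v) -> adj v (stem v) /\ ht (stem v) = 1%N.
Proof.
move=> ev; have [w [vw hw] _] := height1_nbr_uniq treeT unm bal edge0 ev.
rewrite /stem; case: pickP => [z /andP[vz /eqP]//|/(_ w)]; by rewrite vw hw.
Qed.

Lemma stem_uniq v w : ~~ odd (ht v) -> adj v w -> ht w = 1%N -> stem v = w.
Proof.
move=> ev vw hw; have [w' _ uniq] := height1_nbr_uniq treeT unm bal edge0 ev.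
by have [vs hs] := stemP ev; rewrite (uniq _ vs hs) (uniq _ vw hw).
Qed.

Lemma core_adj w : adj w (core w).
Proof.
rewrite /core; case: (pickP (fun u => adj w u && ~~ leaf adj u)) => [u /andP[]//|_] /=.
case: (pickP (adj w)) => [u //|] /=.
by have [u wu] := tree_nbr treeT edge0 w => /(_ u); rewrite wu.
Qed.

Lemma stem_core w : ht w = 1%N -> stem (core w) = w.
Proof.
move=> hw; apply: stem_uniq => //; last by rewrite sym core_adj.
by rewrite (flip (core_adj w)) hw.
Qed.

Lemma core_nonleaf w u : ht w = 1%N -> adj w u -> ~~ leaf adj u -> core w = u.
Proof.
move=> hw wu nlu; rewrite /core.
case: (pickP (fun u => adj w u && ~~ leaf adj u)) => [u' /andP[wu' nlu']|/(_ u)] /=.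
  exact: (height1_nonleaf_uniq treeT unm bal edge0 hw).
by rewrite wu nlu.
Qed.

Lemma repE i : e (rep i) = core (stem (e i)).
Proof.
rewrite /rep; case: pickP => [j /eqP//|no]; have [_ hs] := stemP (e_ht i).
have [|j Ej] := e_surj (v := core (stem (e i))); first by rewrite (flip (core_adj _)) hs.
by have := no j; rewrite Ej eqxx.
Qed.

Lemma repK i : rep (rep i) = rep i.
Proof. by apply: e_inj; rewrite !repE stem_core //; case: (stemP (e_ht i)). Qed.

Definition nbr_set (v : T) : {set 'I_n} := [set i | adj v (e i)].
Definition odd_nbr_sets : seq {set 'I_n} := [seq nbr_set v | v <- enum (Vodd adj)].

Lemma nbr_set_block v i : ht v = 1%N -> rep i = i -> adj v (e i) -> nbr_set v = block rep i.
Proof.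
move=> hv ri vi; have iv : adj (e i) v by rewrite sym.
apply/setP => j; rewrite !inE; have [js hs] := stemP (e_ht j).
apply/idP/eqP => [vj|Ej].
  have jv : adj (e j) v by rewrite sym.
  by apply: e_inj; rewrite -[in RHS]ri !repE !(stem_uniq (e_ht _) _ hv).
rewrite sym; suff <- : stem (e j) = v by [].
by rewrite -(stem_core hs) -repE Ej; apply: stem_uniq => //; apply: e_ht.
Qed.

Lemma block_nbr_set i : rep i = i -> block rep i = nbr_set (stem (e i)).
Proof. by move=> ri; have [i_s hs] := stemP (e_ht i); rewrite (nbr_set_block hs ri) // sym. Qed.

Lemma height1_rep v : ht v = 1%N -> exists2 i, rep i = i & adj v (e i).
Proof.
move=> hv; have [|i Ei] := e_surj (v := core v); first by rewrite (flip (core_adj v)) hv.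
exists i; last by rewrite Ei core_adj.
by apply: e_inj; rewrite repE Ei stem_core.
Qed.

(** At height 3 the neighbours are non-leaves, hence representatives, and each of their blocks also
    contains a leaf. At height 1 the neighbourhood is a whole block; as an edge it would consist of
    its representative alone, against the size condition. *)
Lemma nbr_set_edge v : odd (ht v) -> edge rep (nbr_set v) = (ht v == 3%N).
Proof.
move=> ov; case: (odd_height treeT unm bal edge0 ov) => hv; rewrite hv.
  have [i ri vi] := height1_rep hv; apply/negbTE/negP => /forall_inP edg.
  have := edg i; rewrite inE => /(_ vi) /andP[_]; rewrite -(nbr_set_block hv ri vi).
  case/card_gt1P => j [j' [vj vj' neq]]; case/eqP: neq.
  have E l : l \in nbr_set v -> l = i.
    move=> vl; have /andP[/eqP <- _] := edg l vl.
    by move: vl; rewrite (nbr_set_block hv ri vi) inE => /eqP.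
  by rewrite (E j vj) (E j' vj').
apply/forall_inP => i; rewrite inE => vi.
have [i_s hs] := stemP (e_ht i); have si : adj (stem (e i)) (e i) by rewrite sym.
have nl : ~~ leaf adj (e i).
  apply/negP => li; have := leaf_nbr_height treeT bal edge0 li (v := v).
  by rewrite hv sym vi => /(_ isT).
have ri : rep i = i by apply: e_inj; rewrite repE; apply: core_nonleaf.
rewrite ri eqxx block_nbr_set //; apply/card_gt1P.
have [z sz lz] := height1_leaf treeT bal edge0 hs.
have [|j Ej] := e_surj (v := z); first by rewrite (flip sz) hs.
exists i, j; rewrite !inE si Ej sz; split=> //.
by apply: contraNneq nl => ->; rewrite Ej.
Qed.

Lemma odd_nbr_setsP A : A \in odd_nbr_sets ->
  edge rep A \/ exists2 r, rep r = r & A = block rep r.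
Proof.
case/mapP => v; rewrite mem_enum inE => ov ->; rewrite nbr_set_edge //.
case: (odd_height treeT unm bal edge0 ov) => hv; last by left; rewrite hv.
have [i ri vi] := height1_rep hv; right; exists i => //; exact: nbr_set_block.
Qed.

Lemma block_odd_nbr_sets r : rep r = r -> block rep r \in odd_nbr_sets.
Proof.
move=> rr; rewrite block_nbr_set //; apply: map_f; rewrite mem_enum inE.
by have [_ ->] := stemP (e_ht r).
Qed.

Lemma odd_nbr_sets_neq0 A : A \in odd_nbr_sets -> A != set0.
Proof.
case/mapP => v; rewrite mem_enum inE => ov ->.
have [u vu] := tree_nbr treeT edge0 v; have [|i Ei] := e_surj (v := u).
  by rewrite (flip vu) ov.
by apply/set0Pn; exists i; rewrite inE Ei.
Qed.

Lemma transversalE D : transversal rep odd_nbr_sets D = is_V3TD adj (e @: D).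
Proof.
apply/allP/subsetP => [tD v|vD A /mapP[v]].
  rewrite inE => /eqP hv; have ov : odd (ht v) by rewrite hv.
  have /tD : nbr_set v \in odd_nbr_sets by apply: map_f; rewrite mem_enum inE.
  rewrite nbr_set_edge // hv => /set0Pn[i]; rewrite !inE => /andP[vi iD].
  by apply/exists_inP; exists (e i); [apply: imset_f | rewrite sym].
rewrite mem_enum inE => ov ->; apply/implyP; rewrite nbr_set_edge // => hv.
have := vD v; rewrite inE hv inE => /(_ isT)/exists_inP[x /imsetP[i iD ->] iv].
by apply/set0Pn; exists i; rewrite !inE iD sym iv.
Qed.

(** By minimality each member is adjacent to a vertex of height 3, hence even and indexed by a
    variable. *)
Lemma min_V3TD_even D : minset (is_V3TD adj) D -> D = e @: (e @^-1: D).
Proof.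
case/minsetP => tD minD; apply/setP => x; apply/idP/imsetP => [xD|[i + ->]]; last by rewrite inE.
have : ~~ is_V3TD adj (D :\ x).
  by apply/negP => /minD /(_ (subsetDl _ _)) E; move: xD; rewrite -E !inE eqxx.
case/subsetPn => v v3; rewrite inE => /exists_inPn nv.
have := subsetP tD v v3; rewrite inE => /exists_inP[z zD zv].
have Ez : z = x.
  by apply/eqP; apply: contraT => nz; have := nv z; rewrite !inE nz zD zv => /(_ isT).
have [|i Ei] := e_surj (v := x).
  by move: v3; rewrite inE -Ez => /eqP h3; have := flip zv; rewrite h3 => /esym.
by exists i; rewrite // inE Ei.
Qed.

Lemma card_min_transversal :
  #|[set D | minset (transversal rep odd_nbr_sets) D]| = num_min_V3TD adj.
Proof.
have imI : injective (fun D : {set 'I_n} => e @: D) by apply: imset_inj.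
have preK (D : {set 'I_n}) : e @^-1: (e @: D) = D.
  by apply/setP => i; rewrite inE mem_imset.
rewrite -(card_imset _ imI); apply: eq_card => D; rewrite inE.
apply/imsetP/idP => [[D' + ->]|mD].
  rewrite inE => /minsetP[]; rewrite transversalE => tD minD; apply/minsetP; split=> // B tB sB.
  have EB : B = e @: (e @^-1: B).
    apply/setP => x; apply/idP/imsetP => [xB|[i + ->]]; last by rewrite inE.
    by have /imsetP[i _ Ex] := subsetP sB x xB; exists i; rewrite // inE -Ex.
  suff EBD : e @^-1: B = D' by rewrite EB EBD.
  apply: minD; first by rewrite transversalE -EB.
  by rewrite -(preK D') preimsetS.
exists (e @^-1: D); last exact: min_V3TD_even.
have /minsetP[tD minD] := mD; rewrite inE; apply/minsetP; split.
  by rewrite transversalE -min_V3TD_even.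
move=> B; rewrite transversalE => tB sB; suff EBD : e @: B = D by rewrite -EBD preK.
by apply: minD => //; rewrite [D]min_V3TD_even //; apply: imsetS.
Qed.

Lemma Nodd_cm_type : cm_type (Nodd_gens k adj e) (num_min_V3TD adj).
Proof.
have -> : Nodd_gens k adj e = set_gens k odd_nbr_sets.
  rewrite /set_gens -map_comp; apply: eq_map => v /=.
  by apply: eq_bigl => i; rewrite inE.
rewrite -card_min_transversal; apply: block_cm_type.
- exact: repK.
- exact: odd_nbr_setsP.
- exact: block_odd_nbr_sets.
- exact: odd_nbr_sets_neq0.
Qed.

End NoddIdeal.

(** * The tree without edges, and the main result *)

Lemma cm_type_nil (k : fieldType) : @cm_type k 1 [::] 1.
Proof.
pose X : {mpoly k[1]} := 'X_ord0.
have inX f : in_ideal [:: X] f <-> f@_0%MM = 0.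
  split.
    apply: (@in_ideal_min k 1 (fun f => f@_0%MM = 0)).
      split=> [|g h|h g]; rewrite ?mcoeff0 ?mcoeffD //; first by move=> -> ->; rewrite addr0.
      by rewrite rmorphM /= => ->; rewrite mulr0.
    by move=> g; rewrite inE => /eqP->; rewrite mcoeffX mnm1_eq0.
  have iX := in_ideal_ideal [:: X]; move=> f0; rewrite [f]mpolyE big_seq.
  apply: ideal_sum => // m fm; have [m0|nz] := eqVneq (m ord0) 0%N.
    have Em : m = 0%MM by apply/mnmP => i; rewrite ord1 m0 mnm0E.
    by rewrite Em f0 scale0r; case: iX.
  rewrite -(submK (m := U_(ord0)) (m' := m)) ?lep1mP // mpolyXD; apply: idealZ => //.
  by case: iX => _ _; apply; apply/mem_in_ideal/mem_head.
(* The regular sequence [X] reduces the ring to the field, whose socle is spanned by 1. *)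
apply: (@cm_type_of_reg k 1 [::] [:: X]) => //.
- split=> [[|//] _ f /in_ideal_nil /eqP|]; last first.
    by move/inX; rewrite mcoeff1 eqxx => /eqP; rewrite oner_eq0.
  rewrite mulf_eq0 => /orP[/eqP E|/eqP->]; last exact/in_ideal_nil.
  by have := msuppX k (U_(ord0 : 'I_1))%MM; rewrite [X in msupp X]E msupp0.
- by move=> [|//] _; exists 1%N; split=> //; rewrite homog_degE dhomogX /= mdeg1.
exists [:: 1]; split=> //.
- by move=> [|//] _ i; apply/inX; rewrite ord1 mulr1 mcoeffX mnm1_eq0.
- move=> cs; rewrite big_ord1 /= => /inX; rewrite mcoeffZ mcoeff1 eqxx mulr1.
  by move=> cs0 [|//] _.
- move=> f _; exists [:: f@_0%MM]; apply/inX; rewrite big_ord1 /= mcoeffB mcoeffZ mcoeff1.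
  by rewrite eqxx mulr1 subrr.
Qed.

Theorem theorem5p12 (k : fieldType) (T : finType) (adj : rel T)
  (n : nat) (e : 'I_n -> T) :
  is_tree adj -> unmixed adj -> balanced adj ->
  injective e -> (forall v, v \in Veven adj <-> exists i, e i = v) ->
  cm_type (Nodd_gens k adj e) (num_min_V3TD adj).
Proof.
move=> treeT unm bal e_inj e_even.
have [[a [b ab]]|no_edge] := classic (exists a b, adj a b).
  exact: Nodd_cm_type ab.
(* Without edges the tree is one vertex of height 0: there is one variable and no generator, and the
   empty set is the only minimal [V_3]-TD-set. *)
have ht0 v : height adj v = 0%N.
  rewrite /height; case: ifP => // /existsP[u /cards1P[w Ew]].
  by case: no_edge; exists u, w; have := in_set1 w w; rewrite -Ew inE eqxx.
have one (x y : T) : x = y.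
  case: treeT => _ _ _ conn _; have /connectP[[|z p] /= pth ->] := conn x y => //.
  by case: no_edge; exists x, z; case/andP: pth.
have Vodd0 : Vodd adj = set0 by apply/setP => v; rewrite !inE ht0.
have -> : Nodd_gens k adj e = [::] by rewrite /Nodd_gens Vodd0 enum_set0.
have [x0 _] : exists x : T, true by case: treeT => _ _ /card_gt0P[x _] _ _; exists x.
have [i0 _] : exists i, e i = x0 by apply/e_even; rewrite inE ht0.
have n1 : n = 1%N.
  rewrite -(card_ord n); apply: (@eq_card1 _ i0) => j.
  by rewrite !inE (e_inj j i0 (one _ _)) eqxx.
have -> : num_min_V3TD adj = 1%N.
  rewrite -(cards1 (set0 : {set T})) /num_min_V3TD; apply: eq_card => D; rewrite !inE.
  have V3 C : is_V3TD adj C by apply/subsetP => v; rewrite inE ht0.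
  apply/minsetP/eqP => [[_ minD]|->]; first by apply/esym/minD; rewrite ?sub0set.
  by split=> // B _; rewrite subset0 => /eqP.
by subst n; apply: cm_type_nil.
Qed.
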